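(* Let $\{x_t,y_t\}_{t\ge 0}$ be the sequence generated by the LMO-LMO algorithm (described in the context) with $\tau_t=(t+1)^{-a}$ and $\beta_t=C(t+1)^{-b}$ (where $C>0$ is any constant), or $\beta_t=0$ where indicated. The following hold, where all bounds are for every $T\ge 1$ with constants hidden in $O(\cdot)$ independent of $T$. (i) (Nonconvex-concave.) If the standing assumption holds and $a=\frac56$, $b=\frac16$, then $$\frac{1}{T+1}\sum_{t=0}^T G_{\mathcal X}^{\mathrm{LMO}}(x_t,y_t)\le O(T^{-1/6}),\qquad G_{\mathcal Y}(x_T,y_T)\le O(T^{-1/6}).$$ (ii) (Nonconvex-strongly concave.) If the standing assumption holds with $\mu>0$, and $a=\frac34$, $\beta_t=0$ for all $t$, then $$\frac{1}{T+1}\sum_{t=0}^T G_{\mathcal X}^{\mathrm{LMO}}(x_t,y_t)\le O(T^{-1/4}),\qquad G_{\mathcal Y}(x_T,y_T)\le O(T^{-1/4}).$$ (iii) (Nonconvex-concave, strongly convex $\mathcal Y$.) If the standing assumption holds, $\mathcal Y$ is an $\alpha$-strongly convex set for some $\alpha>0$, and $a=\frac45$, $b=\frac15$, then $$\frac{1}{T+1}\sum_{t=0}^T G_{\mathcal X}^{\mathrm{LMO}}(x_t,y_t)\le O(T^{-1/5}),\qquad G_{\mathcal Y}(x_T,y_T)\le O(T^{-1/5}).$$ (iv) (Nonconvex-strongly concave, strongly convex $\mathcal Y$.) If the standing assumption holds with $\mu>0$, $\mathcal Y$ is an $\alpha$-strongly convex set for some $\alpha>0$, and $a=\frac23$, $\beta_t=0$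 for all $t$, then $$\frac{1}{T+1}\sum_{t=0}^T G_{\mathcal X}^{\mathrm{LMO}}(x_t,y_t)\le O(T^{-1/3}),\qquad G_{\mathcal Y}(x_T,y_T)\le O(T^{-1/3}).$$
   Context: Notation: $\|\cdot\|$ is the Euclidean norm. Standing assumption. $\mathcal X\subset\mathbb R^{d_x}$ and $\mathcal Y\subset\mathbb R^{d_y}$ are nonempty compact convex sets with diameters $D_{\mathcal X}$, $D_{\mathcal Y}$. The payoff $\mathcal L:\mathbb R^{d_x}\times\mathbb R^{d_y}\to\mathbb R$ is continuously differentiable on an open set containing $\mathcal X\times\mathcal Y$; for some $\mu\ge 0$ and every $x\in\mathcal X$, $\mathcal L(x,\cdot)$ is $\mu$-strongly concave on $\mathcal Y$ ($\mu=0$ meaning concave); and there are $L_{xx},L_{yy}\ge 0$, $L_{yx}>0$ such that for all $(x,y),(x',y')\in\mathcal X\times\mathcal Y$, $\|\nabla_x\mathcal L(x,y)-\nabla_x\mathcal L(x',y')\|\le L_{xx}\|x-x'\|+L_{yx}\|y-y'\|$ and $\|\nabla_y\mathcal L(x,y)-\nabla_y\mathcal L(x',y')\|\le L_{yx}\|x-x'\|+L_{yy}\|y-y'\|$. No convexity in $x$ is assumed. Strongly convex set: $\mathcal Y$ is $\alpha$-strongly convex if for all $y,y'\in\mathcal Y$, $z\in\mathbb R^{d_y}$ with $\|z\|=1$, $\xi\in[0,1]$: $\xi y+(1-\xi)y'+\xi(1-\xi)\frac{\alpha}{2}\|y-y'\|^2z\in\mathcal Y$. Gaps: $G_{\mathcal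 Y}(x,y)=\max_{u\in\mathcal Y}\mathcal L(x,u)-\mathcal L(x,y)$ and $G^{\mathrm{LMO}}_{\mathcal X}(x,y)=\max_{v\in\mathcal X}\nabla_x\mathcal L(x,y)^\top(x-v)$. Linear minimization oracle: $\mathrm{LMO}_{\mathcal U}(d)$ denotes an arbitrary element of $\arg\min_{v\in\mathcal U}d^\top v$. Regularized payoff: $\mathcal L_\beta(x,y)=\mathcal L(x,y)-\frac{\beta}{2}\|y-y_0\|^2$, where $y_0\in\mathcal Y$ is the initial dual iterate. LMO-LMO algorithm: start from $x_0\in\mathcal X$, $y_0\in\mathcal Y$; for $t=0,1,2,\dots$: $v_t=\mathrm{LMO}_{\mathcal X}(\nabla_x\mathcal L(x_t,y_t))$, $x_{t+1}=x_t+\tau_t(v_t-x_t)$; $u_t=\mathrm{LMO}_{\mathcal Y}(-\nabla_y\mathcal L_{\beta_t}(x_t,y_t))$, $\gamma_t=\min\left\{\frac{\nabla_y\mathcal L_{\beta_t}(x_t,y_t)^\top(u_t-y_t)}{(L_{yy}+\beta_t)\|u_t-y_t\|^2},1\right\}$, $y_{t+1}=y_t+\gamma_t(u_t-y_t)$ (if $u_t=y_t$, then $y_{t+1}=y_t$). *)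

(* Defs.v *)
From HB Require Import structures.
From mathcomp Require Import all_boot all_order all_algebra.
From mathcomp Require Import all_classical all_reals all_analysis.

Set Implicit Arguments.
Unset Strict Implicit.
Unset Printing Implicit Defensive.

Import Order.TTheory GRing.Theory Num.Theory.
Import numFieldNormedType.Exports.

Local Open Scope classical_set_scope.
Local Open Scope ring_scope.

Definition dot (R : realType) (n : nat) (u v : 'rV[R]_n) : R :=
  \sum_(i < n) u 0 i * v 0 i.

(* The library norm `|u| on 'rV[R]_n is the sup norm, hence this definition. *)
Definition enorm (R : realType) (n : nat) (u : 'rV[R]_n) : R :=
  Num.sqrt (dot u u).

Definition grad (R : realType) (n : nat) (f : 'rV[R]_n -> R) (x : 'rV[R]_n) :
    'rV[R]_n :=
  \row_(i < n) 'D_(delta_mx 0 i) f x.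

Section Problem.
Context (R : realType) (dx dy : nat).
Implicit Types (X : set 'rV[R]_dx) (Y : set 'rV[R]_dy).
Implicit Types (L : 'rV[R]_dx -> 'rV[R]_dy -> R).

Definition gradx L (x : 'rV[R]_dx) (y : 'rV[R]_dy) : 'rV[R]_dx :=
  grad (fun x' => L x' y) x.

Definition grady L (x : 'rV[R]_dx) (y : 'rV[R]_dy) : 'rV[R]_dy :=
  grad (L x) y.

Definition continuously_differentiable_on
    (U : set ('rV[R]_dx * 'rV[R]_dy)) L : Prop :=
  forall p, U p ->
    [/\ differentiable (fun q : 'rV[R]_dx * 'rV[R]_dy => L q.1 q.2) p,
        {for p, continuous
           (fun q : 'rV[R]_dx * 'rV[R]_dy => gradx L q.1 q.2)} &
        {for p, continuous
           (fun q : 'rV[R]_dx * 'rV[R]_dy => grady L q.1 q.2)}].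

Definition strongly_concave_on (mu : R) Y (f : 'rV[R]_dy -> R) : Prop :=
  forall (y y' : 'rV[R]_dy) (xi : R), Y y -> Y y' -> 0 <= xi <= 1 ->
    xi * f y + (1 - xi) * f y'
      + mu / 2 * (xi * (1 - xi)) * enorm (y - y') ^+ 2
    <= f (xi *: y + (1 - xi) *: y').

Definition strongly_convex_set (alpha : R) Y : Prop :=
  forall (y y' z : 'rV[R]_dy) (xi : R),
    Y y -> Y y' -> enorm z = 1 -> 0 <= xi <= 1 ->
    Y (xi *: y + (1 - xi) *: y'
       + (xi * (1 - xi) * (alpha / 2) * enorm (y - y') ^+ 2) *: z).

Record standing_assumption X Y L (mu Lxx Lyy Lyx : R) : Prop := {
  sa_X_nonempty : X !=set0;
  sa_X_compact : compact X;
  sa_X_convex : convex_set X;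
  sa_Y_nonempty : Y !=set0;
  sa_Y_compact : compact Y;
  sa_Y_convex : convex_set Y;
  sa_C1 : exists U : set ('rV[R]_dx * 'rV[R]_dy),
    [/\ open U, X `*` Y `<=` U & continuously_differentiable_on U L];
  sa_mu_ge0 : 0 <= mu;
  sa_concave : forall x, X x -> strongly_concave_on mu Y (L x);
  sa_Lxx_ge0 : 0 <= Lxx;
  sa_Lyy_ge0 : 0 <= Lyy;
  sa_Lyx_gt0 : 0 < Lyx;
  sa_gradx_lipschitz : forall x x' y y', X x -> X x' -> Y y -> Y y' ->
    enorm (gradx L x y - gradx L x' y')
      <= Lxx * enorm (x - x') + Lyx * enorm (y - y');
  sa_grady_lipschitz : forall x x' y y', X x -> X x' -> Y y -> Y y' ->
    enorm (grady L x y - grady L x' y')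
      <= Lyx * enorm (x - x') + Lyy * enorm (y - y')
}.

(* The suprema below are maxima when X and Y are nonempty and compact and
   L x is continuous on Y. *)
Definition gapY Y L (x : 'rV[R]_dx) (y : 'rV[R]_dy) : R :=
  sup [set L x u | u in Y] - L x y.

Definition gapX_LMO X L (x : 'rV[R]_dx) (y : 'rV[R]_dy) : R :=
  sup [set dot (gradx L x y) (x - v) | v in X].

Definition regularized L (y0 : 'rV[R]_dy) (beta : R)
    (x : 'rV[R]_dx) (y : 'rV[R]_dy) : R :=
  L x y - beta / 2 * enorm (y - y0) ^+ 2.

Definition is_LMO (n : nat) (U : set 'rV[R]_n) (d v : 'rV[R]_n) : Prop :=
  U v /\ forall w, U w -> dot d v <= dot d w.

(* When u = y the quotient has a zero denominator, but the value of the step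
   size is then irrelevant since it multiplies u - y. *)
Definition dual_step L (Lyy : R) (y0 : 'rV[R]_dy) (beta : R)
    (x : 'rV[R]_dx) (y u : 'rV[R]_dy) : R :=
  Num.min (dot (grady (regularized L y0 beta) x y) (u - y)
             / ((Lyy + beta) * enorm (u - y) ^+ 2)) 1.

Record LMO_LMO X Y L (Lyy : R) (tau beta : nat -> R)
    (x0 : 'rV[R]_dx) (y0 : 'rV[R]_dy)
    (x v : nat -> 'rV[R]_dx) (y u : nat -> 'rV[R]_dy) : Prop := {
  ll_x0 : x 0%N = x0;
  ll_y0 : y 0%N = y0;
  ll_v : forall t, is_LMO X (gradx L (x t) (y t)) (v t);
  ll_x : forall t, x t.+1 = x t + tau t *: (v t - x t);
  ll_u : forall t,
    is_LMO Y (- grady (regularized L y0 (beta t)) (x t) (y t)) (u t);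
  ll_y : forall t,
    y t.+1 = y t + dual_step L Lyy y0 (beta t) (x t) (y t) (u t)
                     *: (u t - y t)
}.

(* Both gaps are O(T^-r).  The constant K depends on the problem, the step
   sizes and the initial point, but neither on T nor on which minimizers the
   oracles return. *)
Definition LMO_LMO_rate X Y L (Lyy : R) (tau beta : nat -> R)
    (x0 : 'rV[R]_dx) (y0 : 'rV[R]_dy) (r : R) : Prop :=
  exists K : R,
    forall (x v : nat -> 'rV[R]_dx) (y u : nat -> 'rV[R]_dy),
      LMO_LMO X Y L Lyy tau beta x0 y0 x v y u ->
      forall T : nat, (1 <= T)%N ->
        (T.+1%:R)^-1 * \sum_(0 <= t < T.+1) gapX_LMO X L (x t) (y t)
          <= K * T%:R `^ (- r)
        /\ gapY Y L (x T) (y T) <= K * T%:R `^ (- r).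

End Problem.

(* Main.v *)
Require Import Defs.
From mathcomp Require Import all_boot all_order all_algebra.
From mathcomp Require Import all_classical all_reals all_analysis.
From mathcomp Require Import ring lra.
Import Order.TTheory GRing.Theory Num.Theory.
Import numFieldNormedType.Exports.
Local Open Scope classical_set_scope.
Local Open Scope ring_scope.

(** Write [N = t + 1] and let [h_t] be the dual gap of the regularized payoff at
[(x_t, y_t)], that is, the maximum over [Y] of [L_beta(x_t, .)] minus
[L_beta(x_t, y_t)], with [beta = beta_t].  The regularized payoff is strongly
concave in [y] with modulus [sigma = mu + beta], so the distance from [y_t] to
the maximizer is at most [2 * sqrt (h_t / sigma)].  Two effects compete in
[h_t].

- The dual step decreases it.  Since the gap is at most the Frank-Wolfe gap, a
  full step gains at least half of it, and a short step on an arbitrary [Y]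
  gains a multiple of [h ^ 2].  When [Y] is strongly convex, the Frank-Wolfe gap
  also dominates the gradient norm times the squared length of the step, and the
  gradient norm is at least of order [sqrt (sigma * h)]; the gain is then of
  order [sqrt sigma * h ^ (3 / 2)] (lemmas [gap_progress_diameter] and
  [gap_progress_strongly_convex]).
- The primal step increases it, but only in proportion to the distance between
  [y_t] and the maximizer: [sqrt h] moves by at most a constant times [tau /
  sqrt sigma] (lemma [sqrt_gap_lipschitz]).  Lowering [beta] adds a term of
  order [beta_t - beta_(t+1)].

With [tau = N ^ (r - 1)] and [sigma] of order at least [N ^ -e], the drift is of
order [(sqrt w + 1) / N] for the rescaled gap [w = N ^ p * h], [p = 2 * r + e],
while the gain is at least of order [w * sqrt w / N] once [w >= 1].  Hence [w]
stays bounded ([recursion_rate]).  The exponent [e] is [r] when the modulus is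
the one of the regularization and [0] when [mu > 0].  The gain has the required
order when [2 * p <= 1] for arbitrary [Y] and when [3 * p + e <= 2] for strongly
convex [Y]; taking equality gives [r = 1/6, 1/4, 1/5, 1/3] in the four cases.

The bound on the gap in [y] follows, since removing the regularization costs at
most a multiple of [beta], itself of order [N ^ -r].  For the gap in [x], the
value function, the maximum over [y] of the regularized payoff, decreases along
a primal step by [tau] times the linear minimization gap, up to [tau] times the
distance from [y_t] to the maximizer ([value_increment_le]); the latter is of
order [N ^ -r]. Dividing by [tau] and summing by parts, the values contribute
their oscillation times [N ^ (1 - r)] and the errors the sum of the [N ^ -r], so
that the average is of order [N ^ -r]. *)

(** * Euclidean geometry of row vectors *)

Section Euclid.
Context {R : realType} {n : nat}.
Implicit Types (u v w : 'rV[R]_n) (a : R).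

Lemma dotC u v : dot u v = dot v u.
Proof. by apply: eq_bigr => i _; rewrite mulrC. Qed.

Lemma dotDr u v w : dot u (v + w) = dot u v + dot u w.
Proof.
by rewrite /dot -big_split; apply: eq_bigr => i _; rewrite mxE mulrDr.
Qed.

Lemma dotZr a u v : dot u (a *: v) = a * dot u v.
Proof.
by rewrite /dot mulr_sumr; apply: eq_bigr => i _; rewrite mxE mulrCA.
Qed.

Lemma dotNr u v : dot u (- v) = - dot u v.
Proof. by rewrite -scaleN1r dotZr mulN1r. Qed.

Lemma dotBr u v w : dot u (v - w) = dot u v - dot u w.
Proof. by rewrite dotDr dotNr. Qed.

Lemma dotDl u v w : dot (u + v) w = dot u w + dot v w.
Proof. by rewrite dotC dotDr !(dotC w). Qed.

Lemma dotZl a u v : dot (a *: u) v = a * dot u v.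
Proof. by rewrite dotC dotZr dotC. Qed.

Lemma dotNl u v : dot (- u) v = - dot u v.
Proof. by rewrite dotC dotNr dotC. Qed.

Lemma dotBl u v w : dot (u - v) w = dot u w - dot v w.
Proof. by rewrite dotDl dotNl. Qed.

Definition dotE := (dotDl, dotDr, dotNl, dotNr, dotZl, dotZr).

Lemma dot_ge0 u : 0 <= dot u u.
Proof. by apply: sumr_ge0 => i _; rewrite -expr2 sqr_ge0. Qed.

Lemma enorm_ge0 u : 0 <= enorm u.
Proof. exact: sqrtr_ge0. Qed.

Lemma enorm_sqr u : enorm u ^+ 2 = dot u u.
Proof. by rewrite sqr_sqrtr // dot_ge0. Qed.

Lemma dot_eq0 u : dot u u = 0 -> u = 0.
Proof.
move=> /eqP; rewrite psumr_eq0 => [/allP u0|i _]; last first.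
  by rewrite -expr2 sqr_ge0.
apply/rowP => i; rewrite mxE; apply/eqP.
by have := u0 i (mem_index_enum _); rewrite mulf_eq0 orbb.
Qed.

Lemma enorm_eq0 u : enorm u = 0 -> u = 0.
Proof. by move=> u0; apply: dot_eq0; rewrite -enorm_sqr u0 expr0n. Qed.

Lemma enormZ a u : enorm (a *: u) = `|a| * enorm u.
Proof.
by rewrite /enorm dotZl dotZr mulrA -expr2 sqrtrM ?sqr_ge0// sqrtr_sqr.
Qed.

Lemma enormN u : enorm (- u) = enorm u.
Proof. by rewrite -scaleN1r enormZ normrN1 mul1r. Qed.

Lemma sqdist_gt0 u v : u != v -> 0 < enorm (u - v) ^+ 2.
Proof.
move=> uv; rewrite exprn_gt0// lt_def enorm_ge0 andbT.
by apply: contra uv => /eqP/enorm_eq0/eqP; rewrite subr_eq0.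
Qed.

Lemma enorm0 : enorm (0 : 'rV[R]_n) = 0.
Proof. by rewrite -(scale0r (0 : 'rV[R]_n)) enormZ normr0 mul0r. Qed.

Lemma dot_le_enorm u v : dot u v <= enorm u * enorm v.
Proof.
suff: dot u v ^+ 2 <= dot u u * dot v v.
  move=> uv; apply: (le_trans (ler_norm _)).
  rewrite -(@ler_pXn2r _ 2) ?nnegrE ?mulr_ge0 ?enorm_ge0//.
  by rewrite real_normK ?num_real// exprMn !enorm_sqr.
have [v0|v0] := eqVneq (dot v v) 0.
  by rewrite (dot_eq0 v v0) -(scale0r (0 : 'rV_n)) !dotZr !mul0r expr0n mulr0.
have vp : 0 < dot v v by rewrite lt_def v0 dot_ge0.
have := dot_ge0 (dot v v *: u - dot u v *: v).
rewrite !dotE (dotC v u).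
set a := dot u u; set b := dot v v; set c := dot u v => h.
rewrite -subr_ge0 -(pmulr_rge0 _ vp); apply: le_trans h _.
by rewrite le_eqVlt; apply/orP; left; apply/eqP; rewrite -/b; ring.
Qed.

Lemma enorm_bounded (A : set 'rV[R]_n) : bounded_set A ->
  exists2 D : R, 0 < D & forall u v, A u -> A v -> enorm (u - v) <= D.
Proof.
move=> /ex_strict_bound_gt0[B B0 AB].
have Ai u i : A u -> `|u 0 i| <= B.
  move=> /AB/ltW; apply: le_trans.
  rewrite (_ : `|u| = mx_norm u)// mx_normrE.
  exact: (le_bigmax _ (fun ij : 'I_1 * 'I_n => `|u ij.1 ij.2|) (0, i)).
exists (Num.sqrt (n%:R * (2 * B) ^+ 2) + 1) => [|u v Au Av].
  by rewrite ltr_wpDl ?sqrtr_ge0.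
apply: le_trans (_ : Num.sqrt (n%:R * (2 * B) ^+ 2) <= _); last first.
  by rewrite lerDl.
rewrite ler_wsqrtr//.
apply: le_trans (_ : \sum_(i < n) (2 * B) ^+ 2 <= _).
  apply: ler_sum => i _; rewrite -expr2 -real_normK ?num_real//.
  rewrite lerXn2r ?nnegrE//.
    by lra.
  rewrite !mxE; apply: le_trans (ler_normB _ _) _.
  by rewrite mulr_natl mulr2n lerD ?Ai.
by rewrite sumr_const card_ord -[leLHS]mulr_natl.
Qed.

End Euclid.

(** * Differential calculus along segments *)

Lemma differentiable_dot_grad {R : realType} {n : nat} (f : 'rV[R]_n -> R)
    (a v : 'rV[R]_n) : differentiable f a -> 'd f a v = dot (grad f a) v.
Proof.
move=> df; rewrite {1}(row_sum_delta v) linear_sum; apply: eq_bigr => i _.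
by rewrite linearZ/= mxE deriveE// mulrC.
Qed.

Lemma is_derive_along {R : realType} {n : nat} (f : 'rV[R]_n -> R)
    (a v : 'rV[R]_n) (s : R) : differentiable f (a + s *: v) ->
  is_derive s 1 (fun t : R => f (a + t *: v)) (dot (grad f (a + s *: v)) v).
Proof.
move=> df; pose g := cst a + ( *:%R ^~ v) : R -> 'rV[R]_n.
have dg : is_diff s g ( *:%R ^~ v).
  by rewrite /g -[( *:%R ^~ v) in X in is_diff _ _ X]add0r; exact: is_diffD.
have dfg : differentiable (f \o g) s.
  by apply: differentiable_comp; [exact: (@ex_diff _ _ _ _ _ _ _ dg)|].
apply: DeriveDef; first exact/diff_derivable.
rewrite deriveE// (diff_comp (@ex_diff _ _ _ _ _ _ _ dg) df)/= diff_val.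
by rewrite scale1r differentiable_dot_grad.
Qed.

Lemma mean_value_le {R : realType} (f df : R -> R) (M : R) :
  (forall s : R, 0 <= s <= 1 -> is_derive s 1 f (df s)) ->
  (forall s, 0 <= s <= 1 -> df s <= M) -> f 1 - f 0 <= M.
Proof.
move=> fdf dfM.
have [|||s] := @MVT_segment R f df 0 1; first exact: ler01.
- by move=> s; rewrite in_itv/= => /andP[s0 s1]; apply: fdf; rewrite !ltW.
- apply: derivable_within_continuous => s; rewrite in_itv/= => s01.
  by have [] := fdf s s01.
by rewrite in_itv/= => s01 ->; rewrite subr0 mulr1 dfM.
Qed.

Lemma convex_combE {R : realType} {n : nat} (x y : 'rV[R]_n) (s : R) :
  s *: x + (1 - s) *: y = y + s *: (x - y).
Proof. by rewrite scalerBl scale1r scalerBr addrCA. Qed.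

Lemma convex_set_segment {R : realType} {n : nat} (A : set 'rV[R]_n)
    x y (s : R) : convex_set A -> A x -> A y -> 0 <= s <= 1 ->
  A (x + s *: (y - x)).
Proof.
move=> cA Ax Ay /andP[s0 s1].
have := cA y x (Itv01 s0 s1) (mem_set Ay) (mem_set Ax).
by rewrite inE; congr A; exact: convex_combE.
Qed.

Lemma sqdistE {R : realType} {n : nat} (c : 'rV[R]_n) :
  (fun z => enorm (z - c) ^+ 2) =
  \sum_(i < n) ((fun z : 'rV[R]_n => z 0 i) - cst (c 0 i)) ^+ 2.
Proof.
apply/funext => z; rewrite enorm_sqr fct_sumE; apply: eq_bigr => i _.
by rewrite !mxE expr2.
Qed.

Lemma is_derive_sqdist {R : realType} {n : nat} (c y v : 'rV[R]_n) :
  is_derive y v (fun z => enorm (z - c) ^+ 2) (2 * dot (y - c) v).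
Proof.
have coord i : is_derive y v (fun z : 'rV[R]_n => z 0 i) (v 0 i).
  have dc : derivable (fun z : 'rV[R]_n => z 0 i) y v.
    exact/diff_derivable/differentiable_coord.
  apply: DeriveDef => //.
  have := @derive_mx R _ 1 n id y v (@derivable_id _ _ _ _).
  by rewrite derive_id => /(congr1 (fun M : 'rV_n => M 0 i)); rewrite mxE => <-.
rewrite sqdistE.
apply: is_derive_eq; rewrite /dot mulr_sumr; apply: eq_bigr => i _.
by rewrite subr0 expr1 !mxE mulrA.
Qed.

Lemma differentiable_sqdist {R : realType} {n : nat} (c y : 'rV[R]_n) :
  differentiable (fun z => enorm (z - c) ^+ 2) y.
Proof.
rewrite sqdistE.
apply: differentiable_sum => i; apply: differentiableX.
exact/differentiableB/differentiable_cst/differentiable_coord.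
Qed.

(** * Consequences of the standing assumption *)

Section Payoff.
Context {R : realType} {dx dy : nat} {X : set 'rV[R]_dx} {Y : set 'rV[R]_dy}
  {L : 'rV[R]_dx -> 'rV[R]_dy -> R} {mu Lxx Lyy Lyx : R}
  (hL : standing_assumption X Y L mu Lxx Lyy Lyx).

Lemma payoff_differentiable x y : X x -> Y y ->
  differentiable (fun q : 'rV[R]_dx * 'rV[R]_dy => L q.1 q.2) (x, y).
Proof.
move=> Xx Yy; have [U [_ XYU dU]] := sa_C1 hL.
by have [] := dU _ (XYU (x, y) (conj Xx Yy)).
Qed.

Lemma payoff_differentiable_x x y : X x -> Y y ->
  differentiable (fun x' => L x' y) x.
Proof.
move=> Xx Yy; pose f (q : 'rV[R]_dx * 'rV[R]_dy) := L q.1 q.2.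
pose g (x' : 'rV[R]_dx) := (x', y).
rewrite (_ : (fun x' => _) = f \o g)//; apply: differentiable_comp.
  exact/differentiable_pair/differentiable_cst.
exact: payoff_differentiable.
Qed.

Lemma payoff_differentiable_y x y : X x -> Y y -> differentiable (L x) y.
Proof.
move=> Xx Yy; pose f (q : 'rV[R]_dx * 'rV[R]_dy) := L q.1 q.2.
pose g (y' : 'rV[R]_dy) := (x, y').
rewrite (_ : L x = f \o g)//; apply: differentiable_comp.
  by apply: differentiable_pair; first exact: differentiable_cst.
exact: payoff_differentiable.
Qed.

Lemma X_segment x x' (s : R) : X x -> X x' -> 0 <= s <= 1 ->
  X (x + s *: (x' - x)).
Proof. by move=> *; apply: convex_set_segment => //; exact: sa_X_convex hL. Qed.

Lemma Y_segment y y' (s : R) : Y y -> Y y' -> 0 <= s <= 1 ->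
  Y (y + s *: (y' - y)).
Proof. by move=> *; apply: convex_set_segment => //; exact: sa_Y_convex hL. Qed.

(** Differentiating the payoff minus the expected quadratic term along the
segment, rather than the payoff alone, gives the sharp constant [Lyy / 2]; the
step size of the algorithm relies on it.  The signs [c = 1] and [c = -1] give
the upper and the lower bound. *)
Lemma payoff_quadratic_bound x y z (c : R) : X x -> Y y -> Y z -> `|c| = 1 ->
  c * (L x z - L x y - dot (grady L x y) (z - y))
    <= Lyy / 2 * enorm (z - y) ^+ 2.
Proof.
move=> Xx Yy Yz c1; set w := z - y.
pose a := Lyy / 2 * enorm w ^+ 2.
have Yw s : 0 <= s <= 1 -> Y (y + s *: w) by exact: Y_segment.
pose f (s : R) := c * L x (y + s *: w) - a * s ^+ 2.
pose df (s : R) := c * dot (grady L x (y + s *: w)) w - a * (2 * s).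
suff: f 1 - f 0 <= c * dot (grady L x y) w.
  by rewrite /f scale1r scale0r addr0 /w subrKC -/w -/a; lra.
apply: (@mean_value_le _ f df) => s s01.
  have dLy := payoff_differentiable_y _ _ Xx (Yw s s01).
  rewrite /f; have dL := is_derive_along _ _ _ _ dLy; apply: is_derive_eq.
  rewrite /df -[LHS]/(c * dot (grady L x (y + s *: w)) w - a * (s * 1 + s * 1)).
  by ring.
have /andP[s0 _] := s01; rewrite /df.
have := sa_grady_lipschitz hL Xx Xx (Yw s s01) Yy.
rewrite subrr enorm0 mulr0 add0r [y + _ - y]addrAC subrr add0r enormZ.
rewrite ger0_norm// => h.
have : dot (c *: (grady L x (y + s *: w) - grady L x y)) w <=
       Lyy * (s * enorm w) * enorm w.
  apply: le_trans (dot_le_enorm _ _) _; rewrite enormZ c1 mul1r.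
  by rewrite ler_wpM2r ?enorm_ge0.
rewrite /a !dotE; lra.
Qed.

(** Concavity compares the chord to [z] with a short initial part of the
segment, of relative length [s]; there the tangent is exact up to [s ^+ 2 * K].
*)
Lemma payoff_le_tangent x y z : X x -> Y y -> Y z ->
  L x z <= L x y + dot (grady L x y) (z - y).
Proof.
move=> Xx Yy Yz; apply/ler_addgt0Pr => e e0.
set K := Lyy / 2 * enorm (z - y) ^+ 2.
have K0 : 0 <= K by rewrite mulr_ge0 ?sqr_ge0 ?divr_ge0 ?(sa_Lyy_ge0 hL).
have eK : 0 < e + K by lra.
pose s : R := e / (e + K); have s0 : 0 < s by rewrite divr_gt0.
have s01 : 0 <= s <= 1 by rewrite ltW//= ler_pdivrMr// mul1r lerDl.
have sK : s * K <= e.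
  by rewrite mulrAC ler_pdivrMr// ler_wpM2l ?(ltW e0)// lerDr ltW.
clearbody s.
have Ys := Y_segment _ _ _ Yy Yz s01.
have := payoff_quadratic_bound _ _ _ 1 Xx Yy Ys (normr1 _).
have := sa_concave hL Xx Yz Yy s01.
rewrite convex_combE [y + _ - y]addrAC subrr add0r enormZ dotZr gtr0_norm//.
rewrite exprMn => h1 h2.
have m0 : 0 <= mu / 2 * (s * (1 - s)) * enorm (z - y) ^+ 2.
  have /andP[_ s1] := s01.
  rewrite !mulr_ge0 ?(sa_mu_ge0 hL) ?enorm_ge0 ?invr_ge0 ?ler0n//.
    exact: ltW.
  by rewrite subr_ge0.
have : s * (L x z - L x y) <= s * (dot (grady L x y) (z - y) + e).
  apply: (@le_trans _ _ (s * (dot (grady L x y) (z - y) + s * K))); last first.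
    by rewrite ler_wpM2l ?lerD2l ?(ltW s0).
  rewrite /K; lra.
by rewrite ler_pM2l//; lra.
Qed.

(** The increment of the payoff between two points of [X] depends on [y] in a
Lipschitz way, because its derivative does. *)
Lemma payoff_increment_lipschitz x x' y y' : X x -> X x' -> Y y -> Y y' ->
  (L x' y' - L x y') - (L x' y - L x y)
    <= Lyx * enorm (y' - y) * enorm (x' - x).
Proof.
move=> Xx Xx' Yy Yy'; set w := x' - x.
have Xw s : 0 <= s <= 1 -> X (x + s *: w) by exact: X_segment.
pose f (s : R) := L (x + s *: w) y' - L (x + s *: w) y.
pose df (s : R) :=
  dot (gradx L (x + s *: w) y') w - dot (gradx L (x + s *: w) y) w.
suff: f 1 - f 0 <= Lyx * enorm (y' - y) * enorm w.
  by rewrite /f scale1r scale0r addr0 /w subrKC; lra.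
apply: (@mean_value_le _ f df) => s s01.
  have := is_derive_along _ _ _ _ (payoff_differentiable_x _ _ (Xw s s01) Yy).
  have := is_derive_along _ _ _ _ (payoff_differentiable_x _ _ (Xw s s01) Yy').
  by move=> d1 d2; apply: is_deriveB.
rewrite /df -dotBl; apply: le_trans (dot_le_enorm _ _) _.
rewrite ler_wpM2r ?enorm_ge0//.
have := sa_gradx_lipschitz hL (Xw s s01) (Xw s s01) Yy' Yy.
by rewrite subrr enorm0 mulr0 add0r.
Qed.

(** Linearising in [x] with the gradient taken at another dual point [y] costs
the distance between the two dual points. *)
Lemma payoff_increment_le x x' y y' : X x -> X x' -> Y y -> Y y' ->
  L x' y' - L x y' <= dot (gradx L x y) (x' - x)
    + (Lxx * enorm (x' - x) + Lyx * enorm (y' - y)) * enorm (x' - x).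
Proof.
move=> Xx Xx' Yy Yy'; set w := x' - x.
have Xw s : 0 <= s <= 1 -> X (x + s *: w) by exact: X_segment.
pose f (s : R) := L (x + s *: w) y'.
set M := (X in _ <= X); suff: f 1 - f 0 <= M.
  by rewrite /f scale1r scale0r addr0 /w subrKC.
apply: (@mean_value_le _ f (fun s => dot (gradx L (x + s *: w) y') w)) => s s01.
  exact: is_derive_along _ _ _ _ (payoff_differentiable_x _ _ (Xw s s01) Yy').
rewrite -lerBlDl -dotBl; apply: le_trans (dot_le_enorm _ _) _.
rewrite ler_wpM2r ?enorm_ge0//.
apply: le_trans (sa_gradx_lipschitz hL (Xw s s01) Xx Yy' Yy) _.
rewrite lerD2r ler_wpM2l ?(sa_Lxx_ge0 hL)// [x + _ - x]addrAC subrr add0r.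
by have /andP[s0 s1] := s01; rewrite enormZ ger0_norm// ler_piMl ?enorm_ge0.
Qed.

Lemma X_bounded : exists2 D : R, 0 < D &
  forall x x', X x -> X x' -> enorm (x - x') <= D.
Proof. exact/enorm_bounded/compact_bounded/(sa_X_compact hL). Qed.

Lemma Y_bounded : exists2 D : R, 0 < D &
  forall y y', Y y -> Y y' -> enorm (y - y') <= D.
Proof. exact/enorm_bounded/compact_bounded/(sa_Y_compact hL). Qed.

Lemma payoff_bounded : exists2 B : R, 0 < B &
  forall x y, X x -> Y y -> `|L x y| <= B.
Proof.
pose f (q : 'rV[R]_dx * 'rV[R]_dy) := L q.1 q.2.
have : compact (f @` (X `*` Y)).
  apply: continuous_compact; last first.
    exact: compact_setX (sa_X_compact hL) (sa_Y_compact hL).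
  apply: continuous_in_subspaceT => -[x y]; rewrite inE => -[Xx Yy].
  exact/differentiable_continuous/payoff_differentiable.
move=> /compact_bounded/ex_strict_bound_gt0[B B0 fB]; exists B => // x y Xx Yy.
by apply/ltW/fB; exists (x, y).
Qed.

(** * The regularized payoff *)

Context (y0 : 'rV[R]_dy).
Local Notation Lb := (regularized L y0).

Lemma grady_regularized b x y : X x -> Y y ->
  grady (Lb b) x y = grady L x y - b *: (y - y0).
Proof.
move=> Xx Yy; apply/rowP => i; rewrite !mxE.
set v := delta_mx 0 i.
have dL : is_derive y v (L x) ('D_v (L x) y).
  exact/derivableP/diff_derivable/payoff_differentiable_y.
have dq := is_derive_sqdist y0 y v.
rewrite (_ : Lb b x = L x - (b / 2) *: (fun z => enorm (z - y0) ^+ 2))//.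
rewrite (@derive_val _ _ _ _ _ _ _ (is_deriveB dL (is_deriveZ _ dq))).
congr (_ - _); rewrite -[_ *: _]/(_ * _).
have -> : dot (y - y0) v = (y - y0) 0 i.
  rewrite /dot (bigD1 i)//= big1 ?mxE ?eqxx ?mulr1 ?addr0// => j ji.
  by rewrite !mxE (negPf ji) andbF mulr0.
by rewrite !mxE; field.
Qed.

Lemma regularized_strongly_concave b x : X x ->
  strongly_concave_on (mu + b) Y (Lb b x).
Proof.
move=> Xx y y' s Yy Yy' s01; have := sa_concave hL Xx Yy Yy' s01.
rewrite /regularized -(subrKC y0 y) -(subrKC y0 y').
move: (y - y0) (y' - y0) => a a'.
have -> : s *: (y0 + a) + (1 - s) *: (y0 + a') = y0 + (s *: a + (1 - s) *: a').
  by rewrite !scalerDr addrACA -scalerDl subrKC scale1r.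
have -> : y0 + a - (y0 + a') = a - a' by rewrite opprD addrACA subrr add0r.
have shift v : y0 + v - y0 = v by rewrite addrAC subrr add0r.
rewrite !shift !enorm_sqr !dotE (dotC a' a); lra.
Qed.

Lemma regularized_le_tangent b x y z : 0 <= b -> X x -> Y y -> Y z ->
  Lb b x z <= Lb b x y + dot (grady (Lb b) x y) (z - y).
Proof.
move=> b0 Xx Yy Yz; rewrite grady_regularized// dotBl dotZl.
have := payoff_le_tangent _ _ _ Xx Yy Yz; rewrite /regularized.
have -> : z - y0 = (y - y0) + (z - y) by rewrite [RHS]addrC subrKA.
have : 0 <= b * dot (z - y) (z - y) by rewrite mulr_ge0// dot_ge0.
rewrite !enorm_sqr !(dotDl (y - y0)) !(dotDr _ (y - y0)).
rewrite (dotC (z - y) (y - y0)); lra.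
Qed.

Lemma regularized_ge_quadratic b x y z : X x -> Y y -> Y z ->
  Lb b x y + dot (grady (Lb b) x y) (z - y) - (Lyy + b) / 2 * enorm (z - y) ^+ 2
    <= Lb b x z.
Proof.
move=> Xx Yy Yz; rewrite grady_regularized// dotBl dotZl.
have := payoff_quadratic_bound x y z (-1) Xx Yy Yz (normrN1 _).
rewrite /regularized.
have -> : z - y0 = (y - y0) + (z - y) by rewrite [RHS]addrC subrKA.
rewrite !enorm_sqr !(dotDl (y - y0)) !(dotDr _ (y - y0)).
rewrite (dotC (z - y) (y - y0)); lra.
Qed.

End Payoff.

(** * The dual gap of the regularized payoff *)

Lemma half_itv (R : realType) : 0 <= (2^-1 : R) <= 1.
Proof. by rewrite invr_ge0 ler0n invf_le1// ler1n. Qed.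

Section Gap.
Context {R : realType} {dx dy : nat} {X : set 'rV[R]_dx} {Y : set 'rV[R]_dy}
  {L : 'rV[R]_dx -> 'rV[R]_dy -> R} {mu Lxx Lyy Lyx : R}
  (hL : standing_assumption X Y L mu Lxx Lyy Lyx) {y0 : 'rV[R]_dy}.
Local Notation Lb := (regularized L y0).
Local Notation gap b x y := (gapY Y (Lb b) x y).
Local Notation value b x := (sup [set Lb b x u | u in Y]).

Lemma value_attained b x : X x -> exists ys,
  [/\ Y ys, forall u, Y u -> Lb b x u <= Lb b x ys & value b x = Lb b x ys].
Proof.
move=> Xx; have [|||ys] := @compact_EVT_max _ _ (Lb b x) Y.
- exact: sa_Y_nonempty hL.
- exact: sa_Y_compact hL.
- apply: continuous_in_subspaceT => y; rewrite inE => Yy.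
  apply: differentiable_continuous.
  rewrite (_ : Lb b x = L x - (b / 2) *: (fun z => enorm (z - y0) ^+ 2))//.
  apply: differentiableB; first exact: (payoff_differentiable_y hL).
  exact/differentiableZ/differentiable_sqdist.
rewrite inE => Yys ysmax; have {}ysmax u : Y u -> Lb b x u <= Lb b x ys.
  by move=> Yu; apply: ysmax; rewrite inE.
exists ys; split=> //; apply/eqP; rewrite eq_le; apply/andP; split.
  by apply: ge_sup; [exists (Lb b x ys), ys | move=> _ [u Yu <-]; exact: ysmax].
apply: ub_le_sup; last by exists ys.
by exists (Lb b x ys) => _ [u Yu <-]; exact: ysmax.
Qed.

Lemma value_ge b x u : X x -> Y u -> Lb b x u <= value b x.
Proof.
by move=> Xx Yu; have [ys [_ ysmax ->]] := value_attained b x Xx; exact: ysmax.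
Qed.

Lemma gap_ge x y u b : X x -> Y u -> Lb b x u - Lb b x y <= gap b x y.
Proof. by move=> Xx Yu; rewrite lerD2r value_ge. Qed.

Lemma gap_ge0 b x y : X x -> Y y -> 0 <= gap b x y.
Proof. by move=> Xx Yy; have := gap_ge x y y b Xx Yy; rewrite subrr. Qed.

Lemma gap_le_fw_gap b x y u : 0 <= b -> X x -> Y y ->
  is_LMO Y (- grady (Lb b) x y) u ->
  gap b x y <= dot (grady (Lb b) x y) (u - y).
Proof.
move=> b0 Xx Yy [Yu umin].
have [ys [Yys _ vE]] := value_attained b x Xx; rewrite /gapY vE.
have := regularized_le_tangent hL y0 b x y ys b0 Xx Yy Yys.
by have := umin _ Yys; rewrite !dotNl !dotBr; lra.
Qed.

Section StronglyConcave.
Context {b : R} (sigma_gt0 : 0 < mu + b).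
Local Notation sigma := (mu + b).

(** Quadratic growth away from the maximizer, from strong concavity at the
midpoint. *)
Lemma dist_maximizer_le x y ys : X x -> Y y -> Y ys ->
  (forall u, Y u -> Lb b x u <= Lb b x ys) ->
  enorm (ys - y) <= 2 * Num.sqrt (Lb b x ys - Lb b x y) / Num.sqrt sigma.
Proof.
move=> Xx Yy Yys ysmax.
have half := half_itv R.
have := regularized_strongly_concave hL y0 b x Xx ys y 2^-1 Yys Yy half.
have Ym : Y (2^-1 *: ys + (1 - 2^-1) *: y).
  by rewrite convex_combE; exact: Y_segment hL _ _ _ Yy Yys half.
have := ysmax _ Ym => /[swap]/le_trans/[apply] h.
rewrite ler_pdivlMr ?sqrtr_gt0//.
rewrite -(@ler_pXn2r _ 2) ?nnegrE ?mulr_ge0 ?enorm_ge0 ?sqrtr_ge0//.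
rewrite !exprMn !sqr_sqrtr ?subr_ge0 ?ysmax ?dot_ge0 ?(ltW sigma_gt0)//.
by rewrite -enorm_sqr; lra.
Qed.

(** The error of a fixed dual point, measured by the square root of its gap, is
Lipschitz in the primal variable.  The growth bound is used at the new point
[x'], where it controls the gap that is being estimated; this avoids any
regularity of the maximizer as a function of [x]. *)
Lemma sqrt_gap_lipschitz x x' y : X x -> X x' -> Y y ->
  Num.sqrt (gap b x' y)
    <= Num.sqrt (gap b x y) + 2 * (Lyx * enorm (x' - x) / Num.sqrt sigma).
Proof.
move=> Xx Xx' Yy; have [ys [Yys ysmax vE]] := value_attained b x' Xx'.
have h'E : gap b x' y = Lb b x' ys - Lb b x' y by rewrite /gapY vE.
have dist := dist_maximizer_le x' y ys Xx' Yy Yys ysmax.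
have incr := payoff_increment_lipschitz hL _ _ _ _ Xx Xx' Yy Yys.
have h := gap_ge x y ys b Xx Yys.
have h0 := gap_ge0 b x y Xx Yy; have h'0 := gap_ge0 b x' y Xx' Yy.
rewrite -h'E in dist.
set a := Lyx * _ / _.
have a0 : 0 <= a.
  by rewrite divr_ge0 ?sqrtr_ge0// mulr_ge0 ?enorm_ge0 ?(ltW (sa_Lyx_gt0 hL)).
have step : gap b x' y <= gap b x y + 2 * a * Num.sqrt (gap b x' y).
  have e : Lyx * enorm (ys - y) * enorm (x' - x)
      <= 2 * a * Num.sqrt (gap b x' y).
    rewrite (_ : 2 * a * _ = Lyx * enorm (x' - x) *
      (2 * Num.sqrt (gap b x' y) / Num.sqrt sigma)); last by rewrite /a; ring.
    rewrite mulrAC ler_wpM2l// mulr_ge0 ?enorm_ge0//.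
    by rewrite (ltW (sa_Lyx_gt0 hL)).
  by move: incr h e; rewrite h'E /regularized; lra.
set s' := Num.sqrt (gap b x' y); set s := Num.sqrt (gap b x y).
have s0 : 0 <= s := sqrtr_ge0 _; have s'0 : 0 <= s' := sqrtr_ge0 _.
have : s' ^+ 2 <= s ^+ 2 + 2 * a * s' by rewrite !sqr_sqrtr.
move=> s2; rewrite leNgt; apply/negP => lt_s.
have : s ^+ 2 <= s * s' by rewrite expr2 ler_wpM2l//; lra.
have s'p : 0 < s' by lra.
have : (s + 2 * a) * s' < s' * s' by rewrite ltr_pM2r.
by rewrite expr2; lra.
Qed.

(** A vanishing smoothness constant makes [Lb b x] affine on the segment from
[y] to [u], against strong concavity at its midpoint. *)
Lemma smoothness_gt0 x y u : 0 <= b -> X x -> Y y -> Y u -> u != y ->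
  0 < Lyy + b.
Proof.
move=> b0 Xx Yy Yu uy.
have half := half_itv R.
have := regularized_strongly_concave hL y0 b x Xx u y 2^-1 Yu Yy half.
have Ym := Y_segment hL _ _ _ Yy Yu half.
have := regularized_le_tangent hL y0 b x y _ b0 Xx Yy Ym.
have := regularized_ge_quadratic hL y0 b x y u Xx Yy Yu.
rewrite convex_combE [y + _ - y]addrAC subrr add0r dotZr => h1 h2 h3.
have d0 := sqdist_gt0 u y uy.
have s0 : 0 < (mu + b) * enorm (u - y) ^+ 2 by rewrite mulr_gt0.
have : 0 < (Lyy + b) * enorm (u - y) ^+ 2 by lra.
by rewrite pmulr_lgt0.
Qed.

Section DualStep.
Context {x : 'rV[R]_dx} {y u : 'rV[R]_dy}
  (b0 : 0 <= b) (Xx : X x) (Yy : Y y) (hu : is_LMO Y (- grady (Lb b) x y) u).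
Local Notation G := (grady (Lb b) x y).
Local Notation step := (dual_step L Lyy y0 b x y u).

Lemma fw_gap_ge0 : 0 <= dot G (u - y).
Proof.
exact: le_trans (gap_ge0 b x y Xx Yy) (gap_le_fw_gap _ _ _ _ b0 Xx Yy hu).
Qed.

Lemma dual_step_itv : 0 <= step <= 1.
Proof.
rewrite /dual_step ge_min lexx orbT andbT le_min ler01 andbT.
by rewrite divr_ge0 ?fw_gap_ge0// mulr_ge0 ?sqr_ge0 ?addr_ge0 ?(sa_Lyy_ge0 hL).
Qed.

Lemma dual_step_in : Y (y + step *: (u - y)).
Proof. by case: hu => Yu _; exact: Y_segment hL _ _ _ Yy Yu dual_step_itv. Qed.

(** A full step gains at least half the Frank-Wolfe gap [g].  A shorter one, to
the maximizer of the quadratic lower bound, gains at least [step * g / 2]; its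
size is [g] divided by the smoothness constant and the squared length of [u -
y], hence at least [kappa / Lam]. *)
Lemma fw_progress Lam kappa : 0 < Lam -> Lyy + b <= Lam -> 0 <= kappa ->
  kappa * enorm (u - y) ^+ 2 <= dot G (u - y) ->
  gap b x (y + step *: (u - y))
    <= gap b x y - Num.min (gap b x y / 2) (kappa * gap b x y / (2 * Lam)).
Proof.
move=> Lam0 LLam k0 kd; have g0 := fw_gap_ge0.
have hg := gap_le_fw_gap _ _ _ _ b0 Xx Yy hu; have h0 := gap_ge0 b x y Xx Yy.
have Ys := dual_step_in; have /andP[t0 t1] := dual_step_itv.
suff prog : Num.min (gap b x y / 2) (kappa * gap b x y / (2 * Lam))
    <= Lb b x (y + step *: (u - y)) - Lb b x y.
  by move: prog; rewrite /gapY; set m := Num.min _ _; lra.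
have [uy|uy] := eqVneq u y.
  have h00 : gap b x y = 0.
    apply/eqP; rewrite eq_le h0 andbT; move: hg.
    by rewrite uy subrr -(scale0r 0) dotZr mul0r.
  by rewrite h00 uy subrr scaler0 addr0 subrr mul0r mulr0 mul0r minxx.
have [Yu _] := hu; have Lp := smoothness_gt0 x y u b0 Xx Yy Yu uy.
have d0 := sqdist_gt0 u y uy.
set d2 := enorm (u - y) ^+ 2 in d0 kd *.
have Ld0 : 0 < (Lyy + b) * d2 by rewrite mulr_gt0.
have tle : step * ((Lyy + b) * d2) <= dot G (u - y).
  by rewrite -ler_pdivlMr// /dual_step ge_min lexx.
have := regularized_ge_quadratic hL y0 b x y _ Xx Yy Ys.
rewrite [y + _ - y]addrAC subrr add0r dotZr enormZ ger0_norm// exprMn -/d2 => q.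
have half : step * dot G (u - y) / 2 <= Lb b x (y + step *: (u - y)) - Lb b x y.
  have := ler_wpM2l t0 tle; lra.
apply: le_trans half.
have [s1|] := leP 1 (dot G (u - y) / ((Lyy + b) * d2)).
  have -> : step = 1 by rewrite /dual_step min_r.
  by rewrite mul1r ge_min; apply/orP; left; lra.
move=> s1; rewrite ge_min; apply/orP; right.
have ks : kappa / Lam <= step.
  rewrite /dual_step min_l ?(ltW s1)// ler_pdivrMr// mulrAC ler_pdivlMr//.
  rewrite mulrCA; apply: (@le_trans _ _ ((Lyy + b) * dot G (u - y))).
    by rewrite ler_wpM2l// ltW.
  by rewrite mulrC ler_wpM2l.
rewrite ler_pdivrMr in ks => //; rewrite ler_pdivrMr ?mulr_gt0//.
have : kappa * gap b x y <= step * Lam * dot G (u - y) by exact: ler_pM.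
lra.
Qed.

(** Here [kappa] is the gap divided by [D ^+ 2]. *)
Lemma gap_progress_diameter Lam D : 0 < Lam -> Lyy + b <= Lam -> 0 < D ->
  (forall z z', Y z -> Y z' -> enorm (z - z') <= D) ->
  gap b x (y + step *: (u - y))
    <= gap b x y
       - Num.min (gap b x y / 2) (gap b x y ^+ 2 / (2 * Lam * D ^+ 2)).
Proof.
move=> Lam0 LLam D0 YD; have h0 := gap_ge0 b x y Xx Yy.
have D20 : 0 < D ^+ 2 by rewrite exprn_gt0.
have := fw_progress Lam (gap b x y / D ^+ 2) Lam0 LLam.
have -> : gap b x y / D ^+ 2 * gap b x y / (2 * Lam) =
          gap b x y ^+ 2 / (2 * Lam * D ^+ 2).
  by field; rewrite !gt_eqF.
apply; first by rewrite divr_ge0// ltW.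
apply: le_trans (gap_le_fw_gap _ _ _ _ b0 Xx Yy hu).
rewrite mulrAC ler_pdivrMr// ler_wpM2l//.
by rewrite lerXn2r ?nnegrE ?enorm_ge0 ?(ltW D0)// YD//; case: hu.
Qed.

(** Strong convexity of [Y] lets the midpoint of [y] and [u] be pushed in the
direction of the gradient; optimality of [u] against the pushed point gives the
bound. *)
Lemma fw_gap_ge_strongly_convex alpha :
  0 < alpha -> strongly_convex_set alpha Y ->
  alpha / 4 * enorm G * enorm (u - y) ^+ 2 <= dot G (u - y).
Proof.
move=> a0 sY; have [G0|G0] := eqVneq (enorm G) 0.
  by rewrite G0 mulr0 mul0r fw_gap_ge0.
have Gp : 0 < enorm G by rewrite lt_def G0 enorm_ge0.
have [Yu umin] := hu.
have z1 : enorm ((enorm G)^-1 *: G) = 1.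
  by rewrite enormZ ger0_norm ?invr_ge0 ?enorm_ge0// mulVf.
have := umin _ (sY _ _ _ _ Yu Yy z1 (half_itv R)).
have zG : (enorm G)^-1 * dot G G = enorm G by rewrite -enorm_sqr expr2 mulKf.
rewrite !dotNl !dotDr !dotZr zG dotNr; lra.
Qed.

(** The tangent at [y] bounds the gap by the gradient norm times the distance to
the maximizer, and the growth bound turns that distance into [sqrt gap]. *)
Lemma sqrt_gap_le_gradient :
  Num.sqrt (mu + b) * Num.sqrt (gap b x y) <= 2 * enorm G.
Proof.
have [ys [Yys ysmax vE]] := value_attained b x Xx.
have hE : gap b x y = Lb b x ys - Lb b x y by rewrite /gapY vE.
have dist := dist_maximizer_le x y ys Xx Yy Yys ysmax.
have tang := regularized_le_tangent hL y0 b x y ys b0 Xx Yy Yys.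
have cs := dot_le_enorm G (ys - y).
rewrite -hE in dist.
have h0 := gap_ge0 b x y Xx Yy; have s0 := sqrtr_ge0 (gap b x y).
have [sh|sh] := eqVneq (Num.sqrt (gap b x y)) 0.
  by rewrite sh mulr0 mulr_ge0 ?enorm_ge0.
have {}sh : 0 < Num.sqrt (gap b x y) by rewrite lt_def sh.
rewrite -(ler_pM2r sh) -mulrA -expr2 sqr_sqrtr//.
rewrite ler_pdivlMr ?sqrtr_gt0// in dist.
have : enorm G * (enorm (ys - y) * Num.sqrt (mu + b)) <=
       enorm G * (2 * Num.sqrt (gap b x y)) by rewrite ler_wpM2l ?enorm_ge0.
have : gap b x y <= enorm G * enorm (ys - y) by rewrite hE; lra.
move=> /(ler_wpM2l (sqrtr_ge0 (mu + b))); lra.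
Qed.

Lemma gap_progress_strongly_convex Lam alpha : 0 < Lam -> Lyy + b <= Lam ->
  0 < alpha -> strongly_convex_set alpha Y ->
  gap b x (y + step *: (u - y)) <= gap b x y - Num.min (gap b x y / 2)
    (alpha * Num.sqrt (mu + b) * Num.sqrt (gap b x y) * gap b x y / (16 * Lam)).
Proof.
move=> Lam0 LLam a0 sY.
pose kappa := alpha / 8 * (Num.sqrt (mu + b) * Num.sqrt (gap b x y)).
have := fw_progress Lam kappa Lam0 LLam.
have -> : kappa * gap b x y / (2 * Lam) =
    alpha * Num.sqrt (mu + b) * Num.sqrt (gap b x y) * gap b x y / (16 * Lam).
  by rewrite /kappa; field; rewrite gt_eqF.
apply; first by rewrite !mulr_ge0 ?sqrtr_ge0 ?invr_ge0 ?ltW.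
apply: le_trans (fw_gap_ge_strongly_convex alpha a0 sY).
rewrite ler_wpM2r ?sqr_ge0// /kappa.
have := sqrt_gap_le_gradient; set s := _ * _ => /(ler_wpM2l (ltW a0)); lra.
Qed.

End DualStep.

(** Progress of the value function along a primal step.  The gradient is taken
at the current dual point; the error of the maximizer at the new primal point is
bounded by [sqrt_gap_lipschitz]. *)
Lemma value_increment_le x x' y : X x -> X x' -> Y y ->
  value b x' - value b x <= dot (gradx L x y) (x' - x)
    + Lxx * enorm (x' - x) ^+ 2
    + 2 * (Lyx * enorm (x' - x) / Num.sqrt sigma)
        * (Num.sqrt (gap b x y) + 2 * (Lyx * enorm (x' - x) / Num.sqrt sigma)).
Proof.
move=> Xx Xx' Yy; have := sqrt_gap_lipschitz x x' y Xx Xx' Yy.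
set S := _ + 2 * _ => sqS.
have [ys [Yys ysmax vE]] := value_attained b x' Xx'.
have dist := dist_maximizer_le x' y ys Xx' Yy Yys ysmax.
have {}dist : enorm (ys - y) <= 2 * S / Num.sqrt sigma.
  apply: le_trans dist _; rewrite ler_wpM2r ?invr_ge0 ?sqrtr_ge0// ler_wpM2l//.
  by apply: le_trans sqS; apply: ler_wsqrtr; exact: gap_ge.
have incr := payoff_increment_le hL _ _ _ _ Xx Xx' Yy Yys.
have := value_ge b x ys Xx Yys.
have : Lyx * enorm (x' - x) * enorm (ys - y) <=
       Lyx * enorm (x' - x) * (2 * S / Num.sqrt sigma).
  by rewrite ler_wpM2l// mulr_ge0 ?enorm_ge0// (ltW (sa_Lyx_gt0 hL)).
have -> : 2 * (Lyx * enorm (x' - x) / Num.sqrt sigma) * S =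
          Lyx * enorm (x' - x) * (2 * S / Num.sqrt sigma) by ring.
move: incr; rewrite vE /regularized; set w := Num.sqrt sigma; lra.
Qed.
End StronglyConcave.

Section ChangeOfRegularization.
Context {D : R} (Yy0 : Y y0)
  (YD : forall z z', Y z -> Y z' -> enorm (z - z') <= D).

Lemma sqdist_y0_le y : Y y -> enorm (y - y0) ^+ 2 <= D ^+ 2.
Proof.
move=> Yy; rewrite lerXn2r ?nnegrE ?enorm_ge0 ?YD//.
exact: le_trans (enorm_ge0 (y0 - y0)) (YD _ _ Yy0 Yy0).
Qed.

Lemma value_beta_le b b' x : X x -> b' <= b ->
  value b' x <= value b x + (b - b') / 2 * D ^+ 2.
Proof.
move=> Xx bb'; have [ys [Yys _ ->]] := value_attained b' x Xx.
have := value_ge b x ys Xx Yys.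
have : (b - b') / 2 * enorm (ys - y0) ^+ 2 <= (b - b') / 2 * D ^+ 2.
  by rewrite ler_wpM2l ?divr_ge0 ?subr_ge0// sqdist_y0_le.
rewrite /regularized; lra.
Qed.

Lemma gap_beta_le b b' x y : X x -> b' <= b ->
  gap b' x y <= gap b x y + (b - b') / 2 * D ^+ 2.
Proof.
move=> Xx bb'; have := value_beta_le b b' x Xx bb'; rewrite /gapY.
have : 0 <= (b - b') / 2 * enorm (y - y0) ^+ 2.
  by rewrite mulr_ge0 ?sqr_ge0// divr_ge0 ?subr_ge0.
set v' := sup _; set v := sup _; rewrite /regularized; lra.
Qed.

Lemma gapY_le_regularized b x y : 0 <= b -> X x ->
  gapY Y L x y <= gap b x y + b / 2 * D ^+ 2.
Proof.
move=> b0 Xx; have := gap_beta_le b 0 x y Xx b0.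
rewrite subr0 (_ : regularized L y0 0 = L)//.
by apply/funext => x1; apply/funext => y1; rewrite /regularized !mul0r subr0.
Qed.

Lemma value_bounded b x B : 0 <= b -> X x ->
  (forall x' y, X x' -> Y y -> `|L x' y| <= B) -> `|value b x| <= B.
Proof.
move=> b0 Xx LB; rewrite ler_norml; apply/andP; split.
  apply: le_trans (value_ge b x y0 Xx Yy0).
  rewrite /regularized subrr enorm0 expr0n mulr0 subr0.
  by have := LB _ _ Xx Yy0; rewrite ler_norml => /andP[].
have [ys [Yys _ ->]] := value_attained b x Xx; rewrite /regularized.
have : 0 <= b / 2 * enorm (ys - y0) ^+ 2 by rewrite mulr_ge0 ?sqr_ge0 ?divr_ge0.
by have := LB _ _ Xx Yys; rewrite ler_norml => /andP[_]; lra.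
Qed.

Lemma gap_bounded b x y B : 0 <= b -> X x -> Y y ->
  (forall x' y', X x' -> Y y' -> `|L x' y'| <= B) ->
  gap b x y <= 2 * B + b / 2 * D ^+ 2.
Proof.
move=> b0 Xx Yy LB; have := value_bounded b x B b0 Xx LB.
rewrite ler_norml => /andP[_ vB].
have : b / 2 * enorm (y - y0) ^+ 2 <= b / 2 * D ^+ 2.
  by rewrite ler_wpM2l ?divr_ge0// sqdist_y0_le.
have := LB _ _ Xx Yy; rewrite ler_norml => /andP[LB' _].
by move: vB; rewrite /gapY; set v := sup _; rewrite /regularized; lra.
Qed.

End ChangeOfRegularization.
End Gap.

(** * Real sequences with polynomial rates *)

Section Rates.
Context {R : realType}.
Implicit Types (t n : nat) (a b r p c A H : R).

Lemma powS_gt0 t a : 0 < t.+1%:R `^ a.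
Proof. by rewrite powR_gt0. Qed.

Lemma powSD t a b : t.+1%:R `^ (a + b) = t.+1%:R `^ a * t.+1%:R `^ b.
Proof. by rewrite powRD// pnatr_eq0 implybT. Qed.

Lemma ler_powS t a b : a <= b -> t.+1%:R `^ a <= t.+1%:R `^ b.
Proof. by move=> ab; rewrite ler_powR// ler1n. Qed.

Lemma powS_le1 t a : a <= 0 -> t.+1%:R `^ a <= 1.
Proof. by move=> a0; rewrite -[leRHS](powRr0 t.+1%:R) ler_powS. Qed.

Lemma powS1 t : t.+1%:R `^ 1 = t.+1%:R :> R.
Proof. by rewrite powRr1. Qed.

Lemma powSN1 t : t.+1%:R `^ (-1) = t.+1%:R^-1 :> R.
Proof. by rewrite powRN powS1. Qed.

Lemma sqrt_powS t a : Num.sqrt (t.+1%:R `^ a) = t.+1%:R `^ (a / 2).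
Proof. by rewrite powRrM powR12_sqrt ?powR_ge0. Qed.

Lemma powS_succ_le t p : 0 <= p <= 1 ->
  t.+2%:R `^ p <= (1 + t.+1%:R^-1) * t.+1%:R `^ p.
Proof.
move=> /andP[p0 p1]; have -> : t.+2%:R = (1 + t.+1%:R^-1) * t.+1%:R :> R.
  by rewrite mulrDl mulVf ?pnatr_eq0// mul1r -natr1.
rewrite powRM ?addr_ge0// ler_wpM2r ?powR_ge0// ler1_powR// lerDl.
by rewrite invr_ge0.
Qed.

Lemma powS_decrement_le t r : 0 <= r <= 1 ->
  t.+1%:R `^ (- r) - t.+2%:R `^ (- r) <= t.+1%:R `^ (- 1 - r).
Proof.
move=> r01; have rr := powS_succ_le t r r01.
set N : R := t.+1%:R in rr *; have N0 : 0 < N by [].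
have P0 := powS_gt0 t r; have Q0 := powS_gt0 t.+1 r.
rewrite powSD powSN1 !powRN -/N.
set P := N `^ r in P0 rr *; set Q := _ `^ r in Q0 rr *.
have N1 : 0 <= 1 - N^-1 by rewrite subr_ge0 invf_le1 ?ler1n.
clearbody P Q; clearbody N.
rewrite lerBlDl -lerBlDr -[X in X - _]mul1r -mulrBl.
rewrite ler_pdivrMr// mulrC ler_pdivlMr//.
have := ler_wpM2l N1 rr.
have : 0 <= N^-1 * N^-1 * P by rewrite !mulr_ge0 ?invr_ge0 ?ltW.
lra.
Qed.

Lemma sum_powS_le n r : 0 <= r <= 2^-1 ->
  \sum_(0 <= t < n) t.+1%:R `^ (- r) <= 2 * n%:R `^ (1 - r).
Proof.
move=> /andP[r0 r2]; elim: n => [|n IH].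
  by rewrite big_geq// mulr_ge0 ?powR_ge0.
rewrite big_nat_recr//=; apply: le_trans (lerD IH (lexx _)) _.
suff : n%:R `^ (1 - r) <= (1 - n.+1%:R^-1 / 2) * n.+1%:R `^ (1 - r).
  have -> : n.+1%:R `^ (- r) = n.+1%:R^-1 * n.+1%:R `^ (1 - r).
    by rewrite -powSN1 -powSD; congr (_ `^ _); ring.
  by move: (n.+1%:R^-1) (n.+1%:R `^ _) => i P; lra.
set N : R := n.+1%:R; have N0 : 0 < N by [].
have N1 : N^-1 <= 1 by rewrite invf_le1 ?ler1n.
have Ni : 0 < N^-1 by rewrite invr_gt0.
have -> : n%:R = (1 - N^-1) * N :> R.
  by rewrite mulrBl mulVf ?gt_eqF// mul1r /N -natr1 addrK.
clearbody N.
rewrite powRM ?subr_ge0 ?(ltW N0)// ler_wpM2r ?powR_ge0//.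
have [N1'|N1'] := eqVneq (1 - N^-1) 0.
  rewrite N1' powR0; lra.
have u0 : 0 < 1 - N^-1 by rewrite lt_def N1' subr_ge0.
(* As 1 - r >= 1 / 2 and the base is at most 1, the square root is the worst case;
   it is at most 1 - N^-1 / 2. *)
apply: (@le_trans _ _ ((1 - N^-1) `^ 2^-1)).
  by apply: ger_powR; lra.
rewrite powR12_sqrt ?(ltW u0)//.
rewrite -(@ler_pXn2r _ 2) ?nnegrE ?sqrtr_ge0//; last by lra.
rewrite sqr_sqrtr ?(ltW u0)//.
have : 0 <= N^-1 ^+ 2 by exact: sqr_ge0.
lra.
Qed.

(** Summation by parts: increasing weights lose at most the last one times the
oscillation. *)
Lemma weighted_telescope_le (w V : nat -> R) B n :
  (forall t, 0 <= w t <= w t.+1) -> (forall t, `|V t| <= B) ->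
  \sum_(0 <= t < n.+1) w t * (V t - V t.+1) <= 2 * B * w n.
Proof.
move=> w_incr VB.
have {}VB t : 0 <= V t + B <= 2 * B.
  by have := VB t; rewrite ler_norml => /andP[? ?]; lra.
suff : \sum_(0 <= t < n.+1) w t * (V t - V t.+1)
    <= 2 * B * w n - w n * (V n.+1 + B).
  have /andP[w0 _] := w_incr n; have /andP[V0 _] := VB n.+1.
  by have := mulr_ge0 w0 V0; lra.
elim: n => [|n IH].
  rewrite big_nat1; have /andP[w0 _] := w_incr 0%N; have /andP[_ V0] := VB 0%N.
  have := ler_wpM2l w0 V0; lra.
rewrite big_nat_recr//=; apply: le_trans (lerD IH (lexx _)) _.
have /andP[_] := w_incr n; rewrite -subr_ge0 => wn; have /andP[_ Vn] := VB n.+1.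
have := ler_wpM2l wn Vn; lra.
Qed.

(** With [w := N ^ p * h], the rescaled gain exceeds the rescaled drift by at
least [w / N] as soon as [sqrt w >= S], which outweighs the factor [1 + 1 / N]
lost in rescaling; below that threshold one step leaves [w <= 4 * S ^+ 2].  In
[S], the summand [H] covers the initial value, [2 * A] the drift below the
threshold, and the quotient by [c] the comparison of the gain with the drift
above it. *)
Lemma recursion_rate (h : nat -> R) p c A H
    (S := 1 + 2 * A + (1 + 2 * A) / c + H)
    (w := fun t => t.+1%:R `^ p * h t) :
  0 <= p <= 1 -> 0 < c -> 0 <= A -> (forall t, 0 <= h t <= H) ->
  (forall t, h t.+1 <= h t + A * (Num.sqrt (w t) + 1) / t.+1%:R) ->
  (forall t, 1 <= w t -> h t.+1 <= h t - c * (w t * Num.sqrt (w t)) / t.+1%:R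
                                   + A * (Num.sqrt (w t) + 1) / t.+1%:R) ->
  forall t, w t <= 4 * S ^+ 2.
Proof.
move=> p01 c0 A0 hH drift gain.
have H0 : 0 <= H by have /andP[h0 hH0] := hH 0%N; exact: le_trans h0 hH0.
have q0 : 0 <= (1 + 2 * A) / c by rewrite divr_ge0 ?ltW//; lra.
have S1 : 1 <= S by rewrite /S; lra.
have SA : 2 * A <= S by rewrite /S; lra.
have SH : H <= S by rewrite /S; lra.
have Sc : 1 + 2 * A <= c * S.
  have -> : 1 + 2 * A = c * ((1 + 2 * A) / c).
    by rewrite mulrCA divff ?mulr1 ?gt_eqF.
  by rewrite ler_wpM2l ?(ltW c0)// /S; lra.
clearbody S; have SS : S <= S ^+ 2 by rewrite expr2 ler_peMr//; lra.
elim=> [|t IH].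
  by rewrite /w powR1 mul1r; have /andP[_] := hH 0%N; lra.
set N : R := t.+1%:R in drift gain *; have N0 : 0 < N by [].
have N1 : 1 <= N by rewrite ler1n.
have Ni : 0 < N^-1 by rewrite invr_gt0.
have Ni1 : N^-1 <= 1 by rewrite invf_le1.
have /andP[p0 p1] := p01.
have P1 : 1 <= N `^ p by have := ler_powS t 0 p p0; rewrite powRr0.
have PN : N `^ p <= N by rewrite ler1_powR.
have {}drift := drift t; have {}gain := gain t; rewrite -/N in drift gain.
have succ := powS_succ_le t p p01; rewrite -/N in succ.
have w0 : 0 <= w t by rewrite mulr_ge0 ?powR_ge0//; case/andP: (hH t).
have sw : Num.sqrt (w t) ^+ 2 = w t by rewrite sqr_sqrtr.
set s := Num.sqrt (w t) in sw drift gain.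
have s0 : 0 <= s := sqrtr_ge0 _; clearbody s.
have /andP[h'0 _] := hH t.+1.
have {}succ : w t.+1 <= (1 + N^-1) * (N `^ p * h t.+1).
  by rewrite mulrA /w ler_wpM2r.
apply: le_trans succ _.
have wE : w t = N `^ p * h t by [].
set P := N `^ p in P1 PN wE *; clearbody P N w.
have rho1 : P / N <= 1 by rewrite ler_pdivrMr// mul1r.
have rhoN : N^-1 <= P / N by rewrite ler_peMl ?(ltW Ni).
have [Ss|sS] := leP S s.
- have w1 : 1 <= w t by rewrite -sw -(expr1n _ 2) lerXn2r ?nnegrE//; lra.
  have sw_le : s <= w t by rewrite -sw expr2 ler_peMr//; lra.
  have E : w t <= c * (w t * s) - A * (s + 1).
    have e1 : (1 + 2 * A) * w t <= c * s * w t.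
      by rewrite ler_wpM2r//; apply: le_trans Sc _; rewrite ler_wpM2l ?(ltW c0).
    have e2 : A * (s + 1) <= 2 * A * w t.
      rewrite [leRHS](_ : _ = A * (2 * w t)); last by ring.
      by rewrite ler_wpM2l//; lra.
    lra.
  have {}gain : P * h t.+1 <= w t - P / N * (c * (w t * s) - A * (s + 1)).
    by have := ler_wpM2l (le_trans ler01 P1) (gain w1); rewrite wE; lra.
  have e3 : N^-1 * w t <= P / N * (c * (w t * s) - A * (s + 1)).
    by apply: ler_pM => //; exact: ltW.
  have : (1 + N^-1) * (P * h t.+1) <= (1 + N^-1) * (w t - N^-1 * w t).
    by rewrite ler_wpM2l//; lra.
  have : 0 <= N^-1 * N^-1 * w t by rewrite !mulr_ge0 ?(ltW Ni).
  by lra.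
- have wS : w t <= S ^+ 2 by rewrite -sw lerXn2r ?nnegrE//; lra.
  have e1 : A * (s + 1) <= S ^+ 2.
    have : A * (s + 1) <= A * (2 * S) by rewrite ler_wpM2l//; lra.
    have : (2 * A) * S <= S * S by rewrite ler_wpM2r//; lra.
    by rewrite expr2; lra.
  have {}drift : P * h t.+1 <= w t + P / N * (A * (s + 1)).
    by have := ler_wpM2l (le_trans ler01 P1) drift; rewrite wE; lra.
  have e2 : P / N * (A * (s + 1)) <= A * (s + 1).
    by rewrite ler_piMl// mulr_ge0//; lra.
  have : (1 + N^-1) * (P * h t.+1) <= 2 * (2 * S ^+ 2).
    by rewrite ler_pM ?mulr_ge0//; lra.
  by lra.
Qed.

End Rates.

(** * Rates of the algorithm *)

Section Rate.
Context {R : realType} {dx dy : nat} {X : set 'rV[R]_dx} {Y : set 'rV[R]_dy}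
  {L : 'rV[R]_dx -> 'rV[R]_dy -> R} {mu Lxx Lyy Lyx : R}
  (hL : standing_assumption X Y L mu Lxx Lyy Lyx)
  {x0 : 'rV[R]_dx} {y0 : 'rV[R]_dy} (Xx0 : X x0) (Yy0 : Y y0).
Local Notation Lb := (regularized L y0).
Local Notation gap b x y := (gapY Y (Lb b) x y).
Local Notation value b x := (sup [set Lb b x u | u in Y]).

Context {DX DY B : R} (DX_gt0 : 0 < DX) (DY_gt0 : 0 < DY) (B_gt0 : 0 < B)
  (XD : forall x x', X x -> X x' -> enorm (x - x') <= DX)
  (YD : forall y y', Y y -> Y y' -> enorm (y - y') <= DY)
  (LB : forall x y, X x -> Y y -> `|L x y| <= B).

(* The modulus mu + beta t of strong concavity decays no faster than N ^ -e.  The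
   exponent p of the dual gap is chosen so that sqrt (gap / modulus) is of order
   N ^ -r. *)
Context {r e sigma0 Cb : R} {beta : nat -> R}
  (r_ge0 : 0 <= r) (e_ge0 : 0 <= e) (p_le : 3 * (2 * r + e) <= 2)
  (sigma0_gt0 : 0 < sigma0) (Cb_ge0 : 0 <= Cb)
  (beta_ge0 : forall t, 0 <= beta t) (beta_decr : forall t, beta t.+1 <= beta t)
  (beta_le : forall t, beta t <= Cb * t.+1%:R `^ (- r))
  (beta_diff : forall t, beta t - beta t.+1 <= Cb * t.+1%:R `^ (- 1 - r))
  (sigma_ge : forall t, sigma0 * t.+1%:R `^ (- e) <= mu + beta t).
Local Notation p := (2 * r + e).
Local Notation tau := (fun t : nat => t.+1%:R `^ (- (1 - r)) : R).
Local Notation sigma t := (mu + beta t).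
Local Notation Lam := (Lyy + Cb + 1).
Local Notation H := (2 * B + Cb / 2 * DY ^+ 2).
Local Notation A0 := (Lyx * DX / Num.sqrt sigma0).
Local Notation K M := (Cb / 2 * DY ^+ 2 + Lxx * DX ^+ 2
                       + 2 * A0 * (Num.sqrt M + 2 * A0)).

Lemma sigma_gt0 t : 0 < sigma t.
Proof. by apply: lt_le_trans (sigma_ge t); rewrite mulr_gt0 ?powS_gt0. Qed.

Lemma beta_le_cst t : beta t <= Cb.
Proof.
by apply: le_trans (beta_le t) _; rewrite ler_piMr ?powS_le1 ?oppr_le0.
Qed.

Lemma Lam_gt0 : 0 < Lam.
Proof. by rewrite ltr_wpDl// addr_ge0// (sa_Lyy_ge0 hL). Qed.

Lemma smoothness_le t : Lyy + beta t <= Lam.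
Proof. by have := beta_le_cst t; lra. Qed.

Lemma gap_le_H t x y : X x -> Y y -> gap (beta t) x y <= H.
Proof.
move=> Xx Yy.
apply: le_trans (gap_bounded hL Yy0 YD _ _ _ B (beta_ge0 t) Xx Yy LB) _.
by rewrite lerD2l ler_wpM2r ?sqr_ge0// ler_pM2r ?beta_le_cst ?invr_gt0.
Qed.

Lemma inv_sqrt_sigma_le t : (Num.sqrt (sigma t))^-1 <=
  t.+1%:R `^ (e / 2) / Num.sqrt sigma0.
Proof.
rewrite -[leRHS]invrK.
rewrite lef_pV2 ?posrE ?invr_gt0 ?divr_gt0 ?powS_gt0 ?sqrtr_gt0 ?sigma_gt0//.
rewrite invf_div -powRN -mulNr -sqrt_powS -sqrtrM ?(ltW sigma0_gt0)//.
exact/ler_wsqrtr/sigma_ge.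
Qed.

Lemma primal_drift_le t x x' : X x -> X x' ->
  Lyx * enorm (tau t *: (x' - x)) / Num.sqrt (sigma t)
    <= A0 * t.+1%:R `^ (r - 1 + e / 2).
Proof.
move=> Xx Xx'; rewrite enormZ ger0_norm ?powR_ge0// opprB powSD.
have Lyx0 := sa_Lyx_gt0 hL.
have P0 := powS_gt0 t (r - 1); set P := _ `^ (r - 1) in P0 *.
have := inv_sqrt_sigma_le t; set i := _^-1; set j := _ `^ _.
move=> ij.
apply: (@le_trans _ _ (Lyx * (P * DX) * (j / Num.sqrt sigma0))); last first.
  by rewrite le_eqVlt; apply/orP; left; apply/eqP; ring.
rewrite ler_pM ?invr_ge0 ?sqrtr_ge0//.
  by rewrite ?mulr_ge0 ?enorm_ge0 ?(ltW P0) ?(ltW Lyx0).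
by rewrite ler_wpM2l ?(ltW Lyx0)// ler_wpM2l ?(ltW P0)// XD.
Qed.

(** The gain of a dual step in the form required by [recursion_rate]: the common
lower bound, for [w >= 1], of the quadratic gain on a general [Y] and of the
gain of order [3 / 2] on a strongly convex one. *)
Definition has_gain (c : R) := forall t x y u, X x -> Y y ->
  is_LMO Y (- grady (Lb (beta t)) x y) u ->
  let w := t.+1%:R `^ p * gap (beta t) x y in 1 <= w ->
  gap (beta t) x (y + dual_step L Lyy y0 (beta t) x y u *: (u - y))
    <= gap (beta t) x y - c * (w * Num.sqrt w) / t.+1%:R.

(** Since [3 / 2 * p <= 1] and the gap is bounded by [H], half the gap is always
a sufficient gain; this takes care of the full steps. *)
Lemma half_gap_gain t h (w := t.+1%:R `^ p * h) : 0 <= h <= H ->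
  (2 * (1 + Num.sqrt H))^-1 * (w * Num.sqrt w) / t.+1%:R <= h / 2.
Proof.
move=> /andP[h0 hH].
have -> : Num.sqrt w = t.+1%:R `^ (p / 2) * Num.sqrt h.
  by rewrite sqrtrM ?powR_ge0// sqrt_powS.
have sh : Num.sqrt h <= 1 + Num.sqrt H.
  by apply: le_trans (ler_wsqrtr hH) _; rewrite lerDr.
have SH : 0 < 1 + Num.sqrt H by rewrite ltr_pwDl ?sqrtr_ge0.
have PN : t.+1%:R `^ p * t.+1%:R `^ (p / 2) <= t.+1%:R.
  by rewrite -powSD -[leRHS]powRr1// ler_powS//; have := p_le; lra.
have N0 : 0 < t.+1%:R :> R by [].
rewrite ler_pdivrMr// ler_pdivrMl ?mulr_gt0//.
rewrite /w; have P0 := powS_gt0 t p; have Q0 := powS_gt0 t (p / 2).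
set P := _ `^ p in PN P0 *; set Q := _ `^ _ in PN Q0 *.
move: (_.+1%:R) N0 PN => N N0 PN.
have s0 := sqrtr_ge0 h; set s := Num.sqrt h in s0 sh *.
set S := 1 + _ in sh SH *.
have -> : P * h * (Q * s) = h * (s * (P * Q)) by ring.
have -> : 2 * S * (h / 2 * N) = h * (S * N) by field.
by rewrite ler_wpM2l// ler_pM// mulr_ge0// ltW.
Qed.

Lemma has_gain_min c x y u t (m : R) (w := t.+1%:R `^ p * gap (beta t) x y) :
  0 < c -> c <= (2 * (1 + Num.sqrt H))^-1 -> X x -> Y y ->
  gap (beta t) x (y + dual_step L Lyy y0 (beta t) x y u *: (u - y))
    <= gap (beta t) x y - Num.min (gap (beta t) x y / 2) m ->
  c * (w * Num.sqrt w) / t.+1%:R <= m ->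
  gap (beta t) x (y + dual_step L Lyy y0 (beta t) x y u *: (u - y))
    <= gap (beta t) x y - c * (w * Num.sqrt w) / t.+1%:R.
Proof.
move=> c0 cH Xx Yy prog cm; apply: le_trans prog _.
rewrite lerD2l lerN2 le_min cm andbT.
have h0 := gap_ge0 hL (y0 := y0) (beta t) x y Xx Yy.
apply: le_trans (half_gap_gain t (gap (beta t) x y) _); last first.
  by rewrite h0 gap_le_H.
rewrite ler_wpM2r ?invr_ge0// ler_wpM2r//.
by rewrite mulr_ge0 ?sqrtr_ge0// mulr_ge0 ?powR_ge0.
Qed.

Lemma has_gain_diameter : 2 * p <= 1 -> exists2 c, 0 < c & has_gain c.
Proof.
move=> p2; set k := 2 * Lam * DY ^+ 2.
have k0 : 0 < k by rewrite !mulr_gt0 ?exprn_gt0 ?Lam_gt0.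
have SH : 0 < 1 + Num.sqrt H by rewrite ltr_pwDl ?sqrtr_ge0.
exists (Num.min (2 * (1 + Num.sqrt H))^-1 k^-1).
  by rewrite lt_min !invr_gt0 mulr_gt0.
set c := Num.min _ _; have c0 : 0 < c by rewrite lt_min !invr_gt0 mulr_gt0.
move=> t x y u Xx Yy hu w w1.
have prog := gap_progress_diameter hL (sigma_gt0 t) (beta_ge0 t) Xx Yy hu
  Lam DY Lam_gt0 (smoothness_le t) DY_gt0 YD.
apply: has_gain_min prog _ => //; first by rewrite ge_min lexx.
rewrite -/w -/k.
have w0 : 0 <= w := le_trans ler01 w1.
have sw : Num.sqrt w <= w.
  have s0 := sqrtr_ge0 w.
  have s1 : 1 <= Num.sqrt w by rewrite -[leLHS]sqrtr1 ler_wsqrtr.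
  by rewrite -[leRHS](sqr_sqrtr w0) expr2 ler_peMr.
have P0 := powS_gt0 t p.
have PN : t.+1%:R `^ p * t.+1%:R `^ p <= t.+1%:R.
  by rewrite -powSD -[leRHS]powRr1// ler_powS; lra.
have N0 : 0 < t.+1%:R :> R by [].
have ck : c <= k^-1 by rewrite ge_min lexx orbT.
have h0 := gap_ge0 hL (y0 := y0) (beta t) x y Xx Yy.
rewrite {}/w in w1 w0 sw *; set h := gap _ _ _ in h0 w0 sw *.
set P := _ `^ p in P0 PN w0 sw *.
apply: (@le_trans _ _ (k^-1 * (P * h * (P * h)) / t.+1%:R)).
  rewrite ler_wpM2r ?invr_ge0//; apply: ler_pM => //; first exact: ltW.
    by rewrite mulr_ge0 ?sqrtr_ge0.
  by rewrite ler_wpM2l.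
rewrite ler_pdivrMr// [leLHS](_ : _ = h ^+ 2 / k * (P * P)); last by ring.
by rewrite ler_wpM2l// divr_ge0 ?sqr_ge0// ltW.
Qed.

(** The factor [sqrt sigma] of the gain costs [N ^ (e / 2)], whence the
condition [3 / 2 * p + e / 2 <= 1]. *)
Lemma has_gain_strongly_convex alpha :
  0 < alpha -> strongly_convex_set alpha Y ->
  3 * p + e <= 2 -> exists2 c, 0 < c & has_gain c.
Proof.
move=> a0 sY pe; set k := alpha * Num.sqrt sigma0 / (16 * Lam).
have k0 : 0 < k by rewrite divr_gt0 ?mulr_gt0 ?sqrtr_gt0 ?Lam_gt0.
have SH : 0 < 1 + Num.sqrt H by rewrite ltr_pwDl ?sqrtr_ge0.
exists (Num.min (2 * (1 + Num.sqrt H))^-1 k).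
  by rewrite lt_min !invr_gt0 mulr_gt0.
set c := Num.min _ _; have c0 : 0 < c by rewrite lt_min !invr_gt0 mulr_gt0.
move=> t x y u Xx Yy hu w w1.
have prog := gap_progress_strongly_convex hL (sigma_gt0 t) (beta_ge0 t) Xx Yy
  hu Lam alpha Lam_gt0 (smoothness_le t) a0 sY.
apply: has_gain_min prog _ => //; first by rewrite ge_min lexx.
rewrite -/w.
have w0 : 0 <= w := le_trans ler01 w1.
have ck : c <= k by rewrite ge_min lexx orbT.
have h0 := gap_ge0 hL (y0 := y0) (beta t) x y Xx Yy.
set h := gap _ _ _ in h0 *.
have N0 : 0 < t.+1%:R :> R by [].
have wE : w * Num.sqrt w = Num.sqrt h * h * (t.+1%:R `^ p * t.+1%:R `^ (p / 2)).
  by rewrite /w -/h sqrtrM ?powR_ge0// sqrt_powS; ring.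
apply: (@le_trans _ _ (k * (w * Num.sqrt w) / t.+1%:R)).
  by rewrite ler_wpM2r ?invr_ge0// ler_wpM2r// mulr_ge0 ?sqrtr_ge0.
rewrite wE ler_pdivrMr//.
have sg : Num.sqrt sigma0 * t.+1%:R `^ (- (e / 2)) <= Num.sqrt (sigma t).
  rewrite -mulNr -sqrt_powS -sqrtrM ?(ltW sigma0_gt0)//.
  exact/ler_wsqrtr/sigma_ge.
have PN : t.+1%:R `^ p * t.+1%:R `^ (p / 2) <= t.+1%:R `^ (- (e / 2)) * t.+1%:R.
  rewrite -[X in _ <= _ * X]powRr1// -!powSD ler_powS; lra.
set s := Num.sqrt h; have s0 : 0 <= s := sqrtr_ge0 _.
have L0 := Lam_gt0.
apply: (@le_trans _ _ (k * (s * h * (t.+1%:R `^ (- (e / 2)) * t.+1%:R)))).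
  by rewrite ler_wpM2l ?(ltW k0)// ler_wpM2l// mulr_ge0.
rewrite [leLHS](_ : _ = alpha * (s * h) * t.+1%:R / (16 * Lam) *
  (Num.sqrt sigma0 * t.+1%:R `^ (- (e / 2)))); last by rewrite /k; ring.
rewrite [leRHS](_ : _ = alpha * (s * h) * t.+1%:R / (16 * Lam) *
  Num.sqrt (sigma t)); last by ring.
rewrite ler_wpM2l// divr_ge0 ?mulr_ge0 ?(ltW a0) ?(ltW L0)//.
Qed.

Lemma A0_ge0 : 0 <= A0.
Proof.
have Lyx0 := ltW (sa_Lyx_gt0 hL).
by rewrite !mulr_ge0 ?invr_ge0 ?sqrtr_ge0 ?(ltW DX_gt0).
Qed.

Lemma K_ge0 M : 0 <= K M.
Proof.
have := A0_ge0; set B0 := A0 => B00; clearbody B0.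
rewrite addr_ge0 ?addr_ge0 ?mulr_ge0 ?addr_ge0 ?mulr_ge0 ?sqrtr_ge0 ?invr_ge0//.
all: by rewrite ?(sa_Lxx_ge0 hL) ?(ltW DY_gt0) ?(ltW DX_gt0).
Qed.

Section Iterates.
Context {x v : nat -> 'rV[R]_dx} {y u : nat -> 'rV[R]_dy}
  (run : LMO_LMO X Y L Lyy tau beta x0 y0 x v y u).
Local Notation h t := (gap (beta t) (x t) (y t)).
Local Notation w t := (t.+1%:R `^ p * h t).
Local Notation A := (4 * A0 + 4 * A0 ^+ 2 + Cb / 2 * DY ^+ 2).
Local Notation S c := (1 + 2 * A + (1 + 2 * A) / c + H).

Lemma tau_itv t : 0 <= tau t <= 1.
Proof.
rewrite powR_ge0 powS_le1//.
by have := r_ge0; have := p_le; have := e_ge0; lra.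
Qed.

Lemma iterates_in t : X (x t) /\ Y (y t).
Proof.
elim: t => [|t [Xt Yt]]; first by rewrite (ll_x0 run) (ll_y0 run).
rewrite (ll_x run) (ll_y run); split.
  have [Xv _] := ll_v run t; exact: (X_segment hL _ _ _ Xt Xv (tau_itv t)).
exact: (dual_step_in hL (beta_ge0 t) Xt Yt (ll_u run t)).
Qed.

Lemma x_succ_sub t : x t.+1 - x t = tau t *: (v t - x t).
Proof. by rewrite (ll_x run) addrAC subrr add0r. Qed.

Lemma h_itv t : 0 <= h t <= H.
Proof. by have [Xt Yt] := iterates_in t; rewrite (gap_ge0 hL)// gap_le_H. Qed.

Lemma sqrt_w t : Num.sqrt (w t) = t.+1%:R `^ (p / 2) * Num.sqrt (h t).
Proof. by rewrite sqrtrM ?powR_ge0// sqrt_powS. Qed.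

(** Apart from the change of [beta], the gap grows by at most [4 * a * sqrt h +
4 * a ^+ 2], where [a], the quotient in [sqrt_gap_lipschitz], is of order [N ^
(r - 1 + e / 2) = N ^ (p / 2) / N]; this is why [sqrt h] combines with it to
[sqrt w / N]. *)
Lemma gap_drift t hp : gap (beta t) (x t) (y t.+1) <= hp -> hp <= h t ->
  h t.+1 <= hp + A * (Num.sqrt (w t) + 1) / t.+1%:R.
Proof.
move=> ghp hph.
have [Xt Yt] := iterates_in t; have [Xt' Yt'] := iterates_in t.+1.
have := gap_beta_le hL Yy0 YD _ _ _ (y t.+1) Xt' (beta_decr t).
have := sqrt_gap_lipschitz hL (y0 := y0) (sigma_gt0 t) _ _ _ Xt Xt' Yt'.
have [Xv _] := ll_v run t; have := primal_drift_le t _ _ Xt Xv.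
rewrite x_succ_sub; set a := _ / _.
have N0 : 0 < t.+1%:R :> R by [].
have -> : t.+1%:R `^ (r - 1 + e / 2) = t.+1%:R `^ (p / 2) / t.+1%:R.
  by rewrite -(powSN1 t) -powSD; congr (_ `^ _); field.
rewrite sqrt_w.
have Q2 : (t.+1%:R `^ (p / 2)) ^+ 2 <= t.+1%:R.
  by rewrite expr2 -powSD -[leRHS]powRr1// ler_powS; have := p_le; lra.
have d := beta_diff t.
have {}d : beta t - beta t.+1 <= Cb / t.+1%:R.
  apply: le_trans d _; rewrite -(powSN1 t) ler_wpM2l// ler_powS//.
  by have := r_ge0; lra.
have Q0 := powS_gt0 t (p / 2); set Q := _ `^ (p / 2) in Q0 Q2 *.
have N1 : 1 <= t.+1%:R :> R by rewrite ler1n.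
move: (t.+1%:R) N0 N1 Q2 d => N N0 N1 Q2 d aQ sq gb.
have a0 : 0 <= a.
  by rewrite divr_ge0 ?sqrtr_ge0// mulr_ge0 ?enorm_ge0 ?(ltW (sa_Lyx_gt0 hL)).
have gp0 := gap_ge0 hL (y0 := y0) (beta t) (x t) (y t.+1) Xt Yt'.
have g'0 := gap_ge0 hL (y0 := y0) (beta t) (x t.+1) (y t.+1) Xt' Yt'.
have sh : Num.sqrt (gap (beta t) (x t) (y t.+1)) <= Num.sqrt (h t).
  by apply: ler_wsqrtr; exact: le_trans ghp hph.
set gp := gap (beta t) (x t) (y t.+1) in ghp gp0 sh sq *.
set g' := gap (beta t) (x t.+1) (y t.+1) in sq gb g'0 *.
set s := Num.sqrt (h t) in sh *; have s0 : 0 <= s := sqrtr_ge0 _.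
have A00 := A0_ge0; set B0 := A0 in A00 aQ *; clearbody B0.
have g'_le : g' <= gp + 4 * (a * s) + 4 * a ^+ 2.
  have q0 : 0 <= Num.sqrt gp := sqrtr_ge0 _.
  have : Num.sqrt g' ^+ 2 <= (Num.sqrt gp + 2 * a) ^+ 2.
    by rewrite lerXn2r ?nnegrE ?sqrtr_ge0// addr_ge0// mulr_ge0.
  have := ler_wpM2l a0 sh.
  rewrite sqr_sqrtr// sqrrD sqr_sqrtr//; move: (Num.sqrt gp) => q.
  by lra.
have as_le : a * s <= B0 * (Q * s) / N.
  by have := ler_wpM2r s0 aQ; lra.
have a2_le : a ^+ 2 <= B0 ^+ 2 / N.
  apply: le_trans (_ : (B0 * (Q / N)) ^+ 2 <= _).
    by rewrite lerXn2r ?nnegrE// mulr_ge0// divr_ge0// ltW.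
  rewrite exprMn ler_wpM2l ?sqr_ge0// expr_div_n ler_pdivrMr ?exprn_gt0//.
  by rewrite expr2 (expr2 N) mulKf// ?gt_eqF// -expr2.
have d_le : (beta t - beta t.+1) / 2 * DY ^+ 2 <= Cb / 2 * DY ^+ 2 / N.
  have := ler_wpM2r (sqr_ge0 DY) d; move: (DY ^+ 2) (N^-1) => D2 i; lra.
have K0 : 0 <= (4 * B0 + 4 * B0 ^+ 2) / N.
  by rewrite divr_ge0 ?(ltW N0)// addr_ge0 ?mulr_ge0 ?sqr_ge0.
have K1 : 0 <= (4 * B0 ^+ 2 + Cb / 2 * DY ^+ 2) * (Q * s) / N.
  rewrite divr_ge0 ?(ltW N0)// mulr_ge0 ?(mulr_ge0 (ltW Q0))//.
  by rewrite addr_ge0 ?mulr_ge0 ?sqr_ge0 ?invr_ge0 ?(ltW DY_gt0).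
have K2 : 0 <= 4 * B0 / N by rewrite divr_ge0 ?mulr_ge0 ?(ltW N0).
move: gb g'_le as_le a2_le d_le K0 K1 K2; clearbody gp g' s a Q.
move: (h t.+1) (DY ^+ 2) (N^-1) (beta t - beta t.+1) => h' D2 i db; lra.
Qed.

Lemma gap_rate c : 0 < c -> has_gain c -> forall t, w t <= 4 * (S c) ^+ 2.
Proof.
move=> c0 gain; have N0 (t : nat) : 0 < t.+1%:R :> R by [].
have A_ge0 : 0 <= A.
  have := A0_ge0; set B0 := A0 => B00; clearbody B0.
  by rewrite !addr_ge0 ?mulr_ge0 ?sqr_ge0 ?invr_ge0 ?(ltW DY_gt0).
apply: (@recursion_rate _ (fun t => h t) p c A H) => //.
- have := r_ge0; have := e_ge0; have := p_le.
  by move=> *; apply/andP; split; lra.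
- exact: h_itv.
- move=> t; apply: gap_drift => //.
  have [Xt Yt] := iterates_in t; rewrite (ll_y run).
  have := fw_progress hL (sigma_gt0 t) (beta_ge0 t) Xt Yt (ll_u run t) Lam 0
    Lam_gt0 (smoothness_le t) (lexx 0).
  rewrite !mul0r min_r ?subr0; last by rewrite divr_ge0// (gap_ge0 hL).
  by apply; exact: (fw_gap_ge0 hL (beta_ge0 t) Xt Yt (ll_u run t)).
- move=> t w1; have [Xt Yt] := iterates_in t; apply: gap_drift.
    by rewrite (ll_y run); exact: (gain t _ _ _ Xt Yt (ll_u run t) w1).
  have w0 := le_trans ler01 w1.
  by rewrite lerBlDr lerDl divr_ge0// mulr_ge0 ?(ltW c0)// mulr_ge0// sqrtr_ge0.
Qed.

Lemma powS_w_le t M : w t <= M -> h t <= M * t.+1%:R `^ (- p).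
Proof. by rewrite powRN mulrC ler_pdivlMr ?powS_gt0// mulrC. Qed.

Lemma gapY_rate t M : 0 <= M -> w t <= M ->
  gapY Y L (x t) (y t) <= (M + Cb / 2 * DY ^+ 2) * t.+1%:R `^ (- r).
Proof.
move=> M0 /powS_w_le hM; have [Xt Yt] := iterates_in t.
apply: le_trans (gapY_le_regularized hL Yy0 YD _ _ (y t) (beta_ge0 t) Xt) _.
have pr : t.+1%:R `^ (- p) <= t.+1%:R `^ (- r) :> R.
  by rewrite ler_powS//; have := r_ge0; have := e_ge0; lra.
have := ler_wpM2l M0 pr; have := ler_wpM2r (sqr_ge0 DY) (beta_le t).
move: hM; move: (t.+1%:R `^ (- p)) (t.+1%:R `^ (- r)) (DY ^+ 2) => P Q D2; lra.
Qed.

Lemma gapX_LMO_le t :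
  gapX_LMO X L (x t) (y t) <= dot (gradx L (x t) (y t)) (x t - v t).
Proof.
have [Xv vmin] := ll_v run t; apply: ge_sup.
  by exists (dot (gradx L (x t) (y t)) (x t - v t)), (v t).
by move=> _ [v' Xv' <-]; rewrite !dotBr lerD2l lerN2 vmin.
Qed.

(** One primal step, divided by the step size [N ^ (r - 1)]. *)
Lemma gapX_step t M : w t <= M ->
  gapX_LMO X L (x t) (y t)
    <= t.+1%:R `^ (1 - r) * (value (beta t) (x t) - value (beta t.+1) (x t.+1))
       + K M * t.+1%:R `^ (- r).
Proof.
move=> wM; apply: le_trans (gapX_LMO_le t) _.
have [Xt Yt] := iterates_in t; have [Xt' Yt'] := iterates_in t.+1.
have [Xv _] := ll_v run t.
have vb := value_beta_le hL Yy0 YD _ _ _ Xt' (beta_decr t).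
have := value_increment_le hL (y0 := y0) (sigma_gt0 t) _ _ _ Xt Xt' Yt.
have := primal_drift_le t _ _ Xt Xv.
rewrite x_succ_sub dotZr enormZ ger0_norm ?powR_ge0//.
rewrite -(opprB (x t)) dotNr enormN.
set G := dot _ _; set d := enorm _; set a := _ / _.
have d0 : 0 <= d := enorm_ge0 _; have dD : d <= DX by exact: XD.
have h0 := gap_ge0 hL (y0 := y0) (beta t) (x t) (y t) Xt Yt.
have sh : Num.sqrt (h t) <= Num.sqrt M * t.+1%:R `^ (- (p / 2)).
  rewrite powRN ler_pdivlMr ?powS_gt0// mulrC -sqrt_w.
  exact: ler_wsqrtr.
have sM0 : 0 <= Num.sqrt M := sqrtr_ge0 _.
have A00 := A0_ge0; set B0 := A0 in A00 *; clearbody B0.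
have a0 : 0 <= a.
  rewrite divr_ge0 ?sqrtr_ge0// mulr_ge0 ?(ltW (sa_Lyx_gt0 hL))//.
  by rewrite mulr_ge0 ?powR_ge0.
have rr := r_ge0; have ee := e_ge0; have pp := p_le.
have Z0 := powS_gt0 t (- r); have T0 := powS_gt0 t (1 - r).
have U0 := powS_gt0 t (- (1 - r)); have E0 := powS_gt0 t (e / 2).
have W0 := powS_gt0 t (r - 1 + e / 2).
move: sh vb; set V := value (beta t) (x t); set V1 := value (beta t) (x t.+1).
set V2 := value (beta t.+1) (x t.+1); set s := Num.sqrt (h t).
have s0 : 0 <= s := sqrtr_ge0 _.
(* Since e / 2 - p / 2 = - r and 2 * r + e <= 1, dividing by the step size turns
   every error term into a multiple of N ^ -r. *)
have : t.+1%:R `^ (1 - r) * (beta t - beta t.+1) <= Cb * t.+1%:R `^ (- r).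
  apply: le_trans (ler_wpM2l (ltW T0) (beta_diff t)) _.
  by rewrite mulrCA ler_wpM2l// -powSD ler_powS//; lra.
have := powSD t (1 - r) (- (1 - r)); rewrite subrr powRr0.
have := powSD t (1 - r) (r - 1 + e / 2).
rewrite [X in _ `^ X = _](_ : _ = e / 2); last by ring.
have : t.+1%:R `^ (- (1 - r)) <= t.+1%:R `^ (- r) :> R.
  by rewrite ler_powS//; lra.
have : t.+1%:R `^ (e / 2) * t.+1%:R `^ (- (p / 2)) <= t.+1%:R `^ (- r) :> R.
  by rewrite -powSD ler_powS//; lra.
have : t.+1%:R `^ (e / 2) * t.+1%:R `^ (r - 1 + e / 2) <= t.+1%:R `^ (- r) :> R.
  by rewrite -powSD ler_powS//; lra.
have := powS_gt0 t (- (p / 2)); move: Z0 T0 U0 E0 W0.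
set P := _ `^ (- (p / 2)); set Z := _ `^ (- r); set T := _ `^ (1 - r).
set U := _ `^ (- (1 - r)); set E := _ `^ (e / 2); set W := _ `^ (r - 1 + e / 2).
move=> Z0 T0 U0 E0 W0 P0 WZ EZ UZ /esym TW /esym TU TD sh vb aW incr.
set sM := Num.sqrt M in sM0 sh *; set D2 := DY ^+ 2 in vb *.
have D20 : 0 <= D2 := sqr_ge0 _.
have Lxx0 := sa_Lxx_ge0 hL.
clearbody G d a V V1 V2 s P Z T U E W sM D2.
have Ta : T * a <= B0 * E by rewrite -TW mulrCA ler_wpM2l// ltW.
have sS : s + 2 * a <= sM * P + 2 * (B0 * W) by lra.
have main1 : T * a * (s + 2 * a) <= B0 * (sM + 2 * B0) * Z.
  apply: (@le_trans _ _ (B0 * E * (sM * P + 2 * (B0 * W)))).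
    apply: ler_pM => //; first exact: mulr_ge0 (ltW T0) _.
    by rewrite addr_ge0// mulr_ge0.
  rewrite [leLHS](_ : _ = B0 * (sM * (E * P) + 2 * B0 * (E * W))); last by ring.
  rewrite -[leRHS]mulrA ler_wpM2l// [leRHS]mulrDl lerD// ler_wpM2l//.
  by rewrite mulr_ge0.
have main2 : T * (Lxx * (U * d) ^+ 2) <= Lxx * DX ^+ 2 * Z.
  have -> : T * (Lxx * (U * d) ^+ 2) = Lxx * d ^+ 2 * U.
    by rewrite [RHS]mulrC -[in RHS](mul1r U) -TU; ring.
  apply: ler_pM => //; first by rewrite mulr_ge0 ?sqr_ge0.
    exact: ltW.
  by rewrite ler_wpM2l// lerXn2r ?nnegrE// ltW.
have main3 : T * (V2 - V1) <= Cb / 2 * D2 * Z.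
  have : V2 - V1 <= (beta t - beta t.+1) / 2 * D2 by lra.
  move=> /(ler_wpM2l (ltW T0)) /le_trans; apply.
  have := ler_wpM2r D20 TD; lra.
have main4 : T * (U * G) = G by rewrite mulrA TU mul1r.
have := ler_wpM2l (ltW T0) incr.
lra.
Qed.

(** The values are weighted by [N ^ (1 - r)], which is increasing, so summation
by parts bounds their contribution by their oscillation times the last weight.
*)
Lemma gapX_average_rate M n : 0 <= M -> (forall t, w t <= M) ->
  (n.+1%:R)^-1 * \sum_(0 <= t < n.+1) gapX_LMO X L (x t) (y t)
    <= 2 * (B + K M) * n.+1%:R `^ (- r).
Proof.
move=> M0 wM.
have rr := r_ge0; have ee := e_ge0; have pp := p_le.
have K0 := K_ge0 M.
set k := K M in K0 *.
have -> : n.+1%:R `^ (- r) = n.+1%:R^-1 * n.+1%:R `^ (1 - r) :> R.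
  by rewrite -(powSN1 n) -powSD; congr (_ `^ _); ring.
rewrite mulrCA ler_wpM2l ?invr_ge0//.
apply: (@le_trans _ _ (\sum_(0 <= t < n.+1)
    (t.+1%:R `^ (1 - r) * (value (beta t) (x t) - value (beta t.+1) (x t.+1))
     + k * t.+1%:R `^ (- r)))).
  by apply: ler_sum => t _; exact: gapX_step.
rewrite big_split/= -mulr_sumr.
have s1 := @weighted_telescope_le _ (fun t => t.+1%:R `^ (1 - r))
  (fun t => value (beta t) (x t)) B n.
have s2 : \sum_(0 <= t < n.+1) t.+1%:R `^ (- r) <= 2 * n.+1%:R `^ (1 - r) :> R.
  by apply: sum_powS_le; apply/andP; split; lra.
apply: le_trans (lerD (s1 _ _) (ler_wpM2l K0 s2)) _.
- move=> t; rewrite powR_ge0/=.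
  apply: ge0_ler_powR; rewrite ?nnegrE//; first by lra.
  by rewrite ler_nat.
- by move=> t; have [Xt _] := iterates_in t; exact: (value_bounded hL Yy0).
by rewrite le_eqVlt; apply/orP; left; apply/eqP; ring.
Qed.

End Iterates.

Lemma rate_of_gain : (exists2 c, 0 < c & has_gain c) ->
  LMO_LMO_rate X Y L Lyy tau beta x0 y0 r.
Proof.
move=> [c c0 gain].
pose A := 4 * A0 + 4 * A0 ^+ 2 + Cb / 2 * DY ^+ 2.
pose M := 4 * (1 + 2 * A + (1 + 2 * A) / c + H) ^+ 2.
pose KX := 2 * (B + K M); pose KY := M + Cb / 2 * DY ^+ 2.
have M0 : 0 <= M by rewrite mulr_ge0 ?sqr_ge0.
have KX0 : 0 <= KX by rewrite mulr_ge0// addr_ge0 ?(ltW B_gt0) ?K_ge0.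
have KY0 : 0 <= KY.
  by rewrite addr_ge0// !mulr_ge0 ?invr_ge0 ?(ltW DY_gt0).
exists (KX + KY) => x v y u run [//|n] _.
have wM := gap_rate run c c0 gain.
have rr := r_ge0.
split.
  apply: le_trans (gapX_average_rate run M _ M0 wM) _.
  rewrite -/KX; apply: ler_pM => //; rewrite ?powR_ge0 ?lerDl//.
  rewrite !powRN lef_pV2 ?posrE ?powS_gt0//.
  by apply: ge0_ler_powR; rewrite ?nnegrE// ler_nat.
apply: le_trans (gapY_rate run n.+1 M M0 (wM n.+1)) _.
rewrite -/KY; apply: ler_pM => //; rewrite ?powR_ge0 ?lerDr//.
rewrite !powRN lef_pV2 ?posrE ?powS_gt0//.
by apply: ge0_ler_powR; rewrite ?nnegrE// ler_nat.
Qed.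

Lemma rate_diameter : 2 * p <= 1 -> LMO_LMO_rate X Y L Lyy tau beta x0 y0 r.
Proof. by move=> p2; apply: rate_of_gain; exact: has_gain_diameter. Qed.

Lemma rate_strongly_convex alpha : 0 < alpha -> strongly_convex_set alpha Y ->
  3 * p + e <= 2 -> LMO_LMO_rate X Y L Lyy tau beta x0 y0 r.
Proof.
by move=> a0 sY pe; apply: rate_of_gain; exact: has_gain_strongly_convex sY pe.
Qed.

End Rate.

Theorem theorem2p1 (R : realType) (dx dy : nat)
  (X : set 'rV[R]_dx) (Y : set 'rV[R]_dy)
  (L : 'rV[R]_dx -> 'rV[R]_dy -> R) (mu Lxx Lyy Lyx C : R)
  (x0 : 'rV[R]_dx) (y0 : 'rV[R]_dy)
  (hL : standing_assumption X Y L mu Lxx Lyy Lyx)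
  (hC : 0 < C) (hx0 : X x0) (hy0 : Y y0) :
  [/\ LMO_LMO_rate X Y L Lyy
        (fun t => t.+1%:R `^ (- (5 / 6))) (fun t => C * t.+1%:R `^ (- (1 / 6)))
        x0 y0 (1 / 6),
      (0 < mu ->
       LMO_LMO_rate X Y L Lyy
         (fun t => t.+1%:R `^ (- (3 / 4))) (fun=> 0)
         x0 y0 (1 / 4)),
      (forall alpha : R, 0 < alpha -> strongly_convex_set alpha Y ->
       LMO_LMO_rate X Y L Lyy
         (fun t => t.+1%:R `^ (- (4 / 5))) (fun t => C * t.+1%:R `^ (- (1 / 5)))
         x0 y0 (1 / 5)) &
      (forall alpha : R, 0 < mu -> 0 < alpha -> strongly_convex_set alpha Y ->
       LMO_LMO_rate X Y L Lyy
         (fun t => t.+1%:R `^ (- (2 / 3))) (fun=> 0)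
         x0 y0 (1 / 3))].
Proof.
have [DX DX0 XD] := X_bounded hL; have [DY DY0 YD] := Y_bounded hL.
have [B B0 LB] := payoff_bounded hL.
have mu0 := sa_mu_ge0 hL.
have decaying r : 0 <= r <= 1 ->
    [/\ forall t, 0 <= C * t.+1%:R `^ (- r),
        forall t, C * t.+2%:R `^ (- r) <= C * t.+1%:R `^ (- r),
        forall t, C * t.+1%:R `^ (- r) - C * t.+2%:R `^ (- r)
                    <= C * t.+1%:R `^ (- 1 - r) &
        forall t, C * t.+1%:R `^ (- r) <= mu + C * t.+1%:R `^ (- r)].
  move=> r01; have /andP[r0 _] := r01; split=> t.
  - by rewrite mulr_ge0 ?powR_ge0 ?ltW.
  - rewrite ler_pM2l// !powRN lef_pV2 ?posrE ?powS_gt0//.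
    by apply: ge0_ler_powR; rewrite ?nnegrE// ler_nat.
  - by rewrite -mulrBr ler_pM2l// powS_decrement_le.
  - by rewrite lerDr.
have constant (r : R) :
    [/\ forall t : nat, 0 <= 0 :> R,
        forall t : nat, 0 <= 0 * t.+1%:R `^ (- r) :> R,
        forall t : nat, 0 - 0 <= 0 * t.+1%:R `^ (- 1 - r) :> R &
        forall t : nat, mu * t.+1%:R `^ (- 0) <= mu + 0].
  by split=> t; rewrite ?subr0 ?mul0r// oppr0 powRr0 mulr1 addr0.
split.
- rewrite (_ : 5 / 6 = 1 - 1 / 6 :> R); last by field.
  have r01 : 0 <= (1 / 6 : R) <= 1 by apply/andP; split; lra.
  have [b0 b1 b3 b4] := decaying _ r01; have /andP[r0 _] := r01.
  apply: (rate_diameter hL hx0 hy0 DX0 DY0 B0 XD YD LB r0 r0 _ hC (ltW hC)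
    b0 b1 (fun=> lexx _) b3 b4); lra.
- move=> mu_gt0; rewrite (_ : 3 / 4 = 1 - 1 / 4 :> R); last by field.
  have r0 : 0 <= (1 / 4 : R) by lra.
  have pe : 3 * (2 * (1 / 4) + 0) <= 2 :> R by lra.
  have [b0 b1 b2 b3] := constant (1 / 4).
  apply: (rate_diameter hL hx0 hy0 DX0 DY0 B0 XD YD LB r0 (lexx 0) pe mu_gt0
    (lexx 0) b0 b0 b1 b2 b3); clear; lra.
- move=> alpha a0 sY; rewrite (_ : 4 / 5 = 1 - 1 / 5 :> R); last by field.
  have r01 : 0 <= (1 / 5 : R) <= 1 by apply/andP; split; lra.
  have [b0 b1 b3 b4] := decaying _ r01; have /andP[r0 _] := r01.
  apply: (rate_strongly_convex hL hx0 hy0 DX0 DY0 B0 XD YD LB r0 r0 _ hC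
    (ltW hC) b0 b1 (fun=> lexx _) b3 b4 alpha a0 sY); lra.
- move=> alpha mu_gt0 a0 sY.
  rewrite (_ : 2 / 3 = 1 - 1 / 3 :> R); last by field.
  have r0 : 0 <= (1 / 3 : R) by lra.
  have pe : 3 * (2 * (1 / 3) + 0) <= 2 :> R by lra.
  have [b0 b1 b2 b3] := constant (1 / 3).
  apply: (rate_strongly_convex hL hx0 hy0 DX0 DY0 B0 XD YD LB r0 (lexx 0) pe
    mu_gt0 (lexx 0) b0 b0 b1 b2 b3 alpha a0 sY); clear; lra.
Qed.
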